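(* Let $K$ be a countable Hilbertian field, let $e\geq 1$, and let $L/K$ be a Galois extension with $L\subseteq K_s$. Then $L[\boldsymbol{\sigma}]_K$ is Hilbertian for almost all $\boldsymbol{\sigma}\in \mathrm{Gal}(K)^e$ (with respect to the normalized Haar measure on $\mathrm{Gal}(K)^e$).
   Context: A field $K$ is Hilbertian if for every irreducible $f\in K[X,Y]$ that is monic and separable in $Y$ there exist infinitely many $a\in K$ with $f(a,Y)$ irreducible in $K[Y]$. $K_s$ denotes a separable closure of $K$ and $\mathrm{Gal}(K)=\mathrm{Gal}(K_s/K)$. For $\boldsymbol{\sigma}=(\sigma_1,\dots,\sigma_e)\in\mathrm{Gal}(K)^e$, $[\boldsymbol{\sigma}]_K$ is the closed normal subgroup of $\mathrm{Gal}(K)$ generated by all conjugates $\sigma_\nu^\tau$, $\nu=1,\dots,e$, $\tau\in\mathrm{Gal}(K)$. For an algebraic extension $L\subseteq K_s$ of $K$, $L[\boldsymbol{\sigma}]_K=\{a\in L : a^\tau=a \text{ for all } \tau\in[\boldsymbol{\sigma}]_K\}$ (the maximal Galois subextension of $L/K$ fixed by each $\sigma_\nu$). $\mathrm{Gal}(K)^e$ is a profinite group and carries its normalized (probability) Haar measure; ''almost all'' means outside a set of measure $0$. *)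

(* Defs.v *)
From HB Require Import structures.
From mathcomp Require Import all_boot all_order all_algebra all_field.
Set Implicit Arguments. Unset Strict Implicit. Unset Printing Implicit Defensive.
Import GRing.Theory.
Local Open Scope ring_scope.

(* Setting: E : fieldType plays the role of K_s; K, L and L[sigma]_K are
   subfields of E given as Prop-valued predicates. *)

Definition is_subfield (E : fieldType) (F : E -> Prop) : Prop :=
  [/\ F 0, F 1,
      (forall x y, F x -> F y -> F (x - y) /\ F (x * y)) &
      (forall x, F x -> F x^-1)].

Definition countable_pred (E : fieldType) (F : E -> Prop) : Prop :=
  exists f : nat -> E, forall x, F x -> exists n, f n = x.

Definition poly_over (E : fieldType) (F : E -> Prop) (p : {poly E}) : Prop :=
  forall i, F p`_i.

Definition sep_closure (E : fieldType) (K : E -> Prop) : Prop :=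
  (forall x : E, exists p : {poly E},
       [/\ poly_over K p, p != 0, root p x & separable_poly p]) /\
  (forall p : {poly E}, (1 < size p)%N -> separable_poly p ->
       exists x, root p x).

Definition Kaut (E : fieldType) (K : E -> Prop) (s : E -> E) : Prop :=
  [/\ {morph s : x y / x + y}, {morph s : x y / x * y}, s 1 = 1,
      bijective s & forall x, K x -> s x = x].

Definition galois_ext (E : fieldType) (K L : E -> Prop) : Prop :=
  [/\ is_subfield L, (forall x, K x -> L x) &
      (forall s x, Kaut K s -> L x -> L (s x))].

(* f : {poly {poly E}} is a polynomial in Y (outer) with coefficients in E[X]. *)
Definition bi_over (E : fieldType) (F : E -> Prop) (f : {poly {poly E}}) : Prop :=
  forall i, poly_over F f`_i.

Definition bi_unit (E : fieldType) (f : {poly {poly E}}) : Prop :=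
  size f = 1%N /\ size f`_0 = 1%N.

Definition bi_irreducible (E : fieldType) (F : E -> Prop) (f : {poly {poly E}}) : Prop :=
  [/\ bi_over F f, f != 0, ~ bi_unit f &
      forall g h, bi_over F g -> bi_over F h -> f = g * h -> bi_unit g \/ bi_unit h].

Definition uni_irreducible (E : fieldType) (F : E -> Prop) (p : {poly E}) : Prop :=
  [/\ poly_over F p, (1 < size p)%N &
      forall g h, poly_over F g -> poly_over F h -> p = g * h ->
        size g = 1%N \/ size h = 1%N].

Definition separable_in_Y (E : fieldType) (f : {poly {poly E}}) : Prop :=
  separable_poly (map_poly (@tofrac _) f : {poly {fraction {poly E}}}).

Definition specialize (E : fieldType) (f : {poly {poly E}}) (a : E) : {poly E} :=
  map_poly (fun c : {poly E} => c.[a]) f.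

Definition hilbertian (E : fieldType) (F : E -> Prop) : Prop :=
  forall f : {poly {poly E}},
    bi_irreducible F f -> f \is monic -> separable_in_Y f ->
    ~ (exists s : seq E, forall a, F a -> uni_irreducible F (specialize f a) -> a \in s).

(* the (abstract) normal subgroup of Gal(K) generated by the conjugates
   of the sigma_nu: finite products of conjugates and their inverses *)
Inductive ngen (E : fieldType) (K : E -> Prop) (e : nat) (sg : 'I_e -> E -> E)
  : (E -> E) -> Prop :=
| ngen_id : ngen K sg id
| ngen_step (g t t' s' : E -> E) (nu : 'I_e) :
    ngen K sg g -> Kaut K t -> cancel t t' -> cancel t' t ->
    (s' = sg nu \/ (cancel s' (sg nu) /\ cancel (sg nu) s')) ->
    ngen K sg (t' \o s' \o t \o g).

(* its closure in the Krull topology: [sigma]_K *)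
Definition closed_normal_gen (E : fieldType) (K : E -> Prop) (e : nat)
  (sg : 'I_e -> E -> E) (tau : E -> E) : Prop :=
  Kaut K tau /\
  forall xs : seq E, exists2 g, ngen K sg g & forall x, x \in xs -> tau x = g x.

Definition fixed_part (E : fieldType) (K L : E -> Prop) (e : nat)
  (sg : 'I_e -> E -> E) : E -> Prop :=
  fun a => L a /\ forall tau, closed_normal_gen K sg tau -> tau a = a.

(* N = index in Gal(K) of the (open) stabilizer of the finite list xs
     = size of the Gal(K)-orbit of xs *)
Definition orbit_size (E : fieldType) (K : E -> Prop) (xs : seq E) (N : nat) : Prop :=
  exists t : seq (seq E),
    [/\ uniq t, (forall y, y \in t <-> exists2 s, Kaut K s & y = map s xs) &
        N = size t].

(* S has normalized Haar (outer) measure 0 in Gal(K)^e: for every eps > 0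
   it is covered by countably many basic open cosets
   U(xs, rho) = {sigma | sigma_nu = rho_nu on xs for all nu},
   of measure N^-e, with total measure < eps. *)
Definition haar_null (E : fieldType) (K : E -> Prop) (e : nat)
  (S : ('I_e -> E -> E) -> Prop) : Prop :=
  forall eps : rat, 0 < eps ->
  exists (xs : nat -> seq E) (rho : nat -> 'I_e -> E -> E) (N : nat -> nat),
    [/\ (forall n i, Kaut K (rho n i)),
        (forall n, orbit_size K (xs n) (N n)),
        (forall sg : 'I_e -> E -> E, (forall i, Kaut K (sg i)) -> S sg ->
           exists n, forall i x, x \in xs n -> sg i x = rho n i x) &
        (forall m, \sum_(n < m) ((N n ^ e)%N%:R)^-1 < eps)].

(* Main.v *)
(* Write M for L[sigma]_K.  As there are countably many polynomials, it suffices
   to treat one f(X,Y), irreducible over M, and sigma in a small open set.  Let f1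
   be an irreducible factor of f over K_s, of degree n; the conjugates of f1 under
   the group generated by Gal(L) and the conjugates of the sigma_nu are all the
   factors of f.

   If every z in M has fewer than n conjugates over the field of coefficients of
   f1, then M lies in a finite extension K(th) of K, and a specialization a in K
   keeping f1(a,Y) irreducible over K(th) is good.  Otherwise choose z in M with n
   conjugates tau_i z and look for a = b(z), with b in K[Z], such that Gal(K(th))
   is jointly transitive on the roots of the n polynomials f1(tau_i a, Y).  Given
   such an a, the conjugate tau_i^-1 sigma_0 tau_i moves the i-th root v_i of
   f1(a,Y) to a fixed root w0 as soon as sigma_0(tau_i v_i) = tau_i w0; these n
   conditions are independent and imply that f(a,Y) is irreducible over M.  Their
   joint probability depends on n only, and enlarging th makes successive
   choices of a independent, so that almost surely one of them succeeds.

   To find b, choose first u_i in K one after another, so that joint transitivity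
   holds for the f1(u_i,Y), and interpolate B(tau_i z) = u_i over K(th).  Writing
   the coefficients of B as polynomials in th over K gives a curve p_i(x) with
   p_i(th) = u_i whose points p_i(s), s in K, have the form b(tau_i z).  The
   polynomial Q(x,Y) whose roots are generic linear combinations of roots of the
   f1(p_i(x),Y) is irreducible over K(th), because Q(th,Y) is; so the Hilbertian
   property of K provides a good s. *)

(* The point a has to be chosen before sigma is known, although M itself depends on sigma. Hence z
   and the coefficients of f1 are put into a Galois extension K(th1) of K, and sigma is prescribed
   there: the group generated by Gal(L) and the conjugates of the sigma_nu acts on K(th1) in a way
   determined by this restriction, so a stays in M and the conjugates of f1 stay the same. The
   automorphism sigma_0 is injective and cannot send n roots of one polynomial to a single w0;
   conjugating by the tau_i moves the n conditions to n different polynomials. The tau_i must fix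
   the coefficients of f1 for tau_i v_i to be a root of f1(tau_i a,Y); this is why conjugates of z
   are counted over the field of these coefficients. There are n^n tuples of roots, and one of them
   is excluded at each stage, so a stage fails with probability 1 - n^-n. No measure is constructed:
   probabilities are ratios of orbit sizes. The countable union runs over f, the finite list of its
   good points, th1 and the images of th1 under the sigma_nu. *)
Require Import Defs.
From HB Require Import structures.
From mathcomp Require Import all_boot all_order all_algebra all_field.
From mathcomp Require Import boolp zify ring lra.

Set Implicit Arguments.
Unset Strict Implicit.
Unset Printing Implicit Defensive.
Import Order.TTheory GRing.Theory Num.Theory.
Local Open Scope ring_scope.

(** * Companion matrices *)

Section Companion.

Definition companion (R : comNzRingType) (n : nat) (p : {poly R}) : 'M[R]_n.+1 :=
  \matrix_(i, j) if i == ord_max then - p`_j else (i.+1 == j :> nat)%:R.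

Lemma map_companion (R R' : comNzRingType) (f : {rmorphism R -> R'}) n p :
  map_mx f (companion n p) = companion n (map_poly f p).
Proof.
apply/matrixP => i j; rewrite !mxE coef_map.
by case: ifP => _; rewrite ?rmorphN ?rmorph_nat.
Qed.

(** Conjugation is written as [M *m V = V *m D], so [V] need not be invertible: cancelling [\det V]
    in an integral domain is enough. This allows polynomial entries. *)
Lemma det_horner_diag (R : idomainType) n (M V : 'M[R]_n.+1) (d : 'rV_n.+1)
    (B : {poly R}) :
  \det V != 0 -> M *m V = V *m diag_mx d ->
  \det (horner_mx M B) = \prod_j B.[d 0 j].
Proof.
move=> V0 MV.
have hV : horner_mx M B *m V = V *m diag_mx (map_mx (horner B) d).
  elim/poly_ind: B => [|B c IH].
    rewrite rmorph0 mul0mx (_ : map_mx _ _ = 0) ?linear0 ?mulmx0 //.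
    by apply/matrixP => i j; rewrite !mxE horner0.
  rewrite rmorphD rmorphM /= horner_mx_X horner_mx_C mulmxDl.
  rewrite -mulmxA MV mulmxA IH -mulmxA mulmx_diag mul_scalar_mx -mul_mx_scalar.
  rewrite -mulmxDr; congr (_ *m _); apply/matrixP => i j.
  by rewrite !mxE -mulrnDl hornerMXaddC.
move/(congr1 determinant): hV; rewrite !det_mulmx mulrC det_diag => /(mulfI V0) ->.
by apply: eq_bigr => j _; rewrite !mxE.
Qed.

(** The column of a root z is (1, z, ..., z^n); the last row of the companion matrix expresses
    z^(n+1) by these powers. *)
Lemma companion_eigen (R : idomainType) n (zs : seq R)
    (A := \prod_(z <- zs) ('X - z%:P)) (d := \row_(j < n.+1) zs`_j) :
  size zs = n.+1 ->
  companion n A *m Vandermonde n.+1 d = Vandermonde n.+1 d *m diag_mx d.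
Proof.
move=> sz; have sA : size A = n.+2 by rewrite size_prod_XsubC sz.
have mA : A \is monic by apply: monic_prod_XsubC.
apply/matrixP => i j; rewrite mul_mx_diag !mxE -exprSr.
have [->|ni] := eqVneq i ord_max; last first.
  have lti : (i.+1 < n.+1)%N.
    by rewrite ltnS ltn_neqAle -ltnS ltn_ord andbT; apply: contra ni => /eqP e; apply/eqP/val_inj.
  rewrite (bigD1 (Ordinal lti)) //= big1 ?addr0; last first.
    move=> k nk; rewrite !mxE (negbTE ni) [(_ == _ :> nat)]eq_sym.
    by rewrite (negbTE (_ : nat_of_ord k != i.+1)) ?mul0r.
  by rewrite !mxE (negbTE ni) eqxx mul1r.
have rA : A.[zs`_j] = 0.
  by apply/eqP; rewrite -/(root A _) root_prod_XsubC mem_nth ?sz.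
move: rA; rewrite horner_coef sA big_ord_recr /=.
have -> : A`_n.+1 = 1 by move/monicP: mA; rewrite /lead_coef sA.
rewrite mul1r addrC => /eqP; rewrite addr_eq0 => /eqP ->.
by rewrite -sumrN; apply: eq_bigr => k _; rewrite !mxE eqxx mulNr.
Qed.

Lemma det_Vandermonde_uniq (R : idomainType) n (zs : seq R) :
  size zs = n.+1 -> uniq zs ->
  \det (Vandermonde n.+1 (\row_(j < n.+1) zs`_j)) != 0.
Proof.
move=> sz uz; rewrite det_Vandermonde; apply/prodf_neq0 => i _.
apply/prodf_neq0 => j ij; rewrite !mxE subr_eq0 nth_uniq ?sz //.
by rewrite gtn_eqF.
Qed.

Lemma big_ord_seq (R S : comNzRingType) n (zs : seq R) (F : R -> S) :
  size zs = n.+1 -> \prod_(j < n.+1) F zs`_j = \prod_(z <- zs) F z.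
Proof. by move=> sz; rewrite [RHS](big_nth 0) sz big_mkord. Qed.

(** This is the norm of B(z). The left side is built from the coefficients alone, hence commutes
    with ring morphisms. *)
Lemma det_horner_companion (R : idomainType) n (zs : seq R) (B : {poly R}) :
  uniq zs -> size zs = n.+1 ->
  \det (horner_mx (companion n (\prod_(z <- zs) ('X - z%:P))) B)
    = \prod_(z <- zs) B.[z].
Proof.
move=> uz sz.
rewrite (det_horner_diag _ (det_Vandermonde_uniq sz uz) (companion_eigen sz)).
rewrite -(big_ord_seq _ sz); by apply: eq_bigr => j _; rewrite !mxE.
Qed.

(* The roots of [sum_poly n c A B] are the sums [c * a + b] of a root [a] of
   [A] (monic of degree [n.+1]) and a root [b] of [B]. *)
Definition sum_poly (R : comNzRingType) n (c : R) (A B : {poly R}) : {poly R} :=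
  \det (horner_mx ('X%:M - c%:P *: map_mx polyC (companion n A)) (map_poly polyC B)).

Lemma map_sum_poly (R R' : comNzRingType) (f : {rmorphism R -> R'}) n c A B :
  map_poly f (sum_poly n c A B) = sum_poly n (f c) (map_poly f A) (map_poly f B).
Proof.
rewrite /sum_poly -det_map_mx map_horner_mx; congr (\det (horner_mx _ _)).
  rewrite map_mxB map_scalar_mx map_mxZ /= map_polyX map_polyC -map_companion.
  rewrite -!map_mx_comp; congr (_ - _ *: _).
  by apply/matrixP => i j; rewrite !mxE /= map_polyC.
by rewrite -!map_poly_comp; apply: eq_map_poly => a /=; rewrite map_polyC.
Qed.

Lemma sum_poly_split (R : idomainType) n c (zs : seq R) (B : {poly R}) :
  uniq zs -> size zs = n.+1 ->
  sum_poly n c (\prod_(z <- zs) ('X - z%:P)) B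
    = \prod_(z <- zs) (B \Po ('X - (c * z)%:P)).
Proof.
move=> uz sz; rewrite /sum_poly.
have e := companion_eigen sz; move: (det_Vandermonde_uniq sz uz) e.
set V := Vandermonde _ _; set C := companion _ _; set d := \row_ _ _ => V0 e.
rewrite (@det_horner_diag _ _ _ (map_mx polyC V)
           (const_mx 'X - c%:P *: map_mx polyC d)).
- rewrite -(big_ord_seq _ sz); apply: eq_bigr => j _; rewrite !mxE -polyCM.
  rewrite comp_polyE horner_coef size_map_polyC; apply: eq_bigr => i _.
  by rewrite coef_map /= mul_polyC.
- by rewrite det_map_mx /= polyC_eq0.
rewrite mulmxBl !linearB /= -scalemxAl -map_mxM e map_mxM map_diag_mx.
by rewrite mul_scalar_mx diag_const_mx mul_mx_scalar !linearZ.
Qed.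

Lemma comp_XsubC_prod (R : comNzRingType) (zs : seq R) b :
  (\prod_(z <- zs) ('X - z%:P)) \Po ('X - b%:P) = \prod_(z <- zs) ('X - (z + b)%:P).
Proof.
rewrite rmorph_prod /=; apply: eq_bigr => z _.
by rewrite comp_polyB comp_polyX comp_polyC polyCD opprD addrA addrAC.
Qed.

End Companion.

(** * Gauss's lemma and specialization *)

Section GaussLemma.

Variable E : fieldType.
Implicit Types (p q : {poly E}) (F G H A d : {poly {poly E}}).

Lemma irreducible_factor p : (1 < size p)%N ->
  exists q, irreducible_poly q /\ q %| p.
Proof.
have [n] := ubnP (size p); elim: n p => // n IH p; rewrite ltnS => ltn sp.
have [irr|] := EM (irreducible_poly p); first by exists p.
move=> nirr; have [q [sq qp nqp]] : exists q, [/\ size q != 1, q %| p & ~~ (q %= p)].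
  apply: contrapT => h; apply: nirr; split=> // q sq qp.
  by apply: contrapT => /negP nqp; apply: h; exists q.
have p0 : p != 0 by rewrite -size_poly_gt0 (ltn_trans _ sp).
have q0 : q != 0 by apply: contraTneq qp => ->; rewrite dvd0p.
have sqp : (size q < size p)%N.
  rewrite ltn_neqAle (dvdp_leq p0 qp) andbT.
  by apply: contra nqp => sqp; rewrite -dvdp_size_eqp.
have s1q : (1 < size q)%N by rewrite ltn_neqAle eq_sym sq size_poly_gt0.
have [r [ir rq]] := IH q (leq_trans sqp ltn) s1q.
by exists r; split=> //; apply: dvdp_trans rq qp.
Qed.

(** Gauss: if i and j are the first indices at which [p] fails to divide the coefficients of [G] and
    [H], then [p] fails to divide the coefficient of index i + j of the product. *)
Lemma prime_content (p : {poly E}) G H : irreducible_poly p ->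
  (forall i, p %| (G * H)`_i) -> (forall i, p %| G`_i) \/ (forall i, p %| H`_i).
Proof.
move=> irr pGH; apply: contrapT => /not_orP [/existsNP nG /existsNP nH].
have exG : exists i, ~~ (p %| G`_i) by case: nG => i /negP; exists i.
have exH : exists i, ~~ (p %| H`_i) by case: nH => i /negP; exists i.
case: (ex_minnP exG) (ex_minnP exH) => i nGi mi [j nHj mj].
have := pGH (i + j)%N; rewrite coefM.
have lti : (i < (i + j).+1)%N by rewrite ltnS leq_addr.
rewrite (bigD1 (Ordinal lti)) //= dvdp_addl; last first.
  apply: (big_ind (fun x => p %| x)) => [|x y|k nk]; [exact: dvdp0|exact: dvdp_add|].
  have [ltk|gek] := ltnP k i.
    rewrite dvdp_mulr //; apply: contraT => nd; by move: (mi _ nd); rewrite leqNgt ltk.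
  rewrite dvdp_mull //; apply: contraT => /mj.
  have ltik : (i < k)%N.
    by rewrite ltn_neqAle gek andbT; apply: contra nk => /eqP e; apply/eqP/val_inj.
  by have := ltn_ord k; lia.
by rewrite addKn Gauss_dvdpr ?irreducible_poly_coprime // (negbTE nHj).
Qed.

Lemma content_div (p : {poly E}) G : (forall i, p %| G`_i) ->
  exists G', G = p *: G'.
Proof.
move=> pG; exists (\poly_(i < size G) (G`_i %/ p)).
apply/polyP => i; rewrite coefZ coef_poly; case: ltnP => [_|si].
  by rewrite mulrC divpK.
by rewrite nth_default // mulr0.
Qed.

(** The irreducible factors of the leading coefficient of [G] are stripped one by one; each divides
    the content of [G] or of [H] by [prime_content], and the degrees of the leading coefficients
    drop. *)
Lemma content_lead F G H : F \is monic -> G != 0 -> H != 0 ->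
  G * H = (lead_coef G * lead_coef H) *: F -> exists d, G = lead_coef G *: d.
Proof.
move=> mF; have [n] := ubnP (size (lead_coef G) + size (lead_coef H)).
elim: n G H => // n IH G H; rewrite ltnS => le_n G0 H0 e.
have lG : lead_coef G != 0 by rewrite lead_coef_eq0.
have [sG|] := leqP (size (lead_coef G)) 1.
  have /size_poly1P [a a0 ea] : size (lead_coef G) == 1.
    by rewrite eqn_leq sG size_poly_gt0.
  exists ((a^-1)%:P *: G).
  by rewrite ea scalerA -polyCM divff // scale1r.
move=> /irreducible_factor [p [irr pG]].
have p0 := irredp_neq0 irr; have pP0 : p%:P != 0 by rewrite polyC_eq0.
have sp : (1 < size p)%N by case: irr.
have pGH i : p %| (G * H)`_i by rewrite e coefZ -mulrA dvdp_mulr.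
have step (u : {poly E}) : u != 0 -> (size u < size (p * u)%R)%N.
  by move=> u0; rewrite size_mul // -subn1 ltn_subRL ltn_add2r.
have ps (A A' : {poly {poly E}}) : A != 0 -> A = p *: A' ->
   [/\ A' != 0 & lead_coef A = p * lead_coef A'].
  move=> A0 eA; split; last by rewrite eA lead_coefZ.
  by apply: contra A0 => /eqP A'0; rewrite eA A'0 scaler0.
case: (prime_content irr pGH) => /content_div [A' eA].
  have [A'0 lA] := ps _ _ G0 eA.
  have [||||d ed] // := IH A' H.
  - apply: leq_trans le_n; rewrite lA ltn_add2r; apply: step.
    by rewrite lead_coef_eq0.
  - apply: (mulfI pP0); rewrite !mul_polyC scalerA mulrA -lA -e.
    by rewrite eA scalerAl.
  by exists d; rewrite lA -scalerA -ed.
have [A'0 lA] := ps _ _ H0 eA.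
have [||||d ed] // := IH G A'; last by exists d.
- apply: leq_trans le_n; rewrite lA ltn_add2l; apply: step.
  by rewrite lead_coef_eq0.
- apply: (mulfI pP0); rewrite !mul_polyC scalerA mulrCA -lA -e.
  by rewrite eA scalerAr.
Qed.

(** Over [{poly E}] the relation [%|] holds only up to nonzero scalars, and such scalars may vanish
    under specialization. Gauss's lemma gives a gcd that is monic and so divides exactly. *)
Lemma monic_gcd F A : F \is monic ->
  exists d, [/\ d \is monic, d %| F, d %| A &
     forall d', d' %| F -> d' %| A -> d' %| d].
Proof.
move=> mF; have F0 := monic_neq0 mF; set G := gcdp F A.
have G0 : G != 0 by rewrite gcdp_eq0 negb_and F0.
have /Pdiv.Idomain.dvdpP [[c H] /= c0 e] : G %| F by apply: dvdp_gcdl.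
have H0 : H != 0.
  apply: contraNneq F0 => H0; move: e; rewrite H0 mul0r => /eqP.
  by rewrite -mul_polyC mulf_eq0 polyC_eq0 (negbTE c0).
have ec : c = lead_coef G * lead_coef H.
  move/(congr1 lead_coef): e; rewrite lead_coefZ (monicP mF) mulr1 lead_coefM.
  by rewrite mulrC.
have [|d ed] := @content_lead F G H mF G0 H0; first by rewrite -ec e mulrC.
have lG : lead_coef G != 0 by rewrite lead_coef_eq0.
have dG : d %= G by rewrite ed eqp_sym eqp_scale.
exists d; split.
- have := congr1 lead_coef ed; rewrite lead_coefZ -{1}[lead_coef G]mulr1.
  by move/(mulfI lG) => ?; apply/eqP.
- by rewrite (eqp_dvdl _ dG) dvdp_gcdl.
- by rewrite (eqp_dvdl _ dG) dvdp_gcdr.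
by move=> d' d'F d'A; rewrite (eqp_dvdr _ dG) dvdp_gcd d'F.
Qed.

End GaussLemma.

Section Specialization.

Variable E : fieldType.
Implicit Types (p q : {poly E}) (F G H A d : {poly {poly E}}).

Lemma specializeE F a : specialize F a = map_poly (horner_eval a) F.
Proof. by []. Qed.

Lemma specializeM F G a : specialize (F * G) a = specialize F a * specialize G a.
Proof. by rewrite !specializeE rmorphM. Qed.

Lemma specialize_monic F a : F \is monic -> specialize F a \is monic.
Proof. by rewrite specializeE; apply: monic_map. Qed.

Lemma size_specialize F a : F \is monic -> size (specialize F a) = size F.
Proof.
move=> /monicP mF; rewrite specializeE size_map_poly_id0 //.
by rewrite mF rmorph1 oner_neq0.
Qed.

Lemma coef_specialize F a i : (specialize F a)`_i = (F`_i).[a].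
Proof. by rewrite specializeE coef_map. Qed.

Lemma specialize_dvdp d F a : d \is monic -> d %| F ->
  specialize d a %| specialize F a.
Proof.
move=> md /(Pdiv.IdomainMonic.dvdpP md) [q ->].
by rewrite specializeM dvdp_mull.
Qed.

Lemma deriv_specialize F a : (specialize F a)^`() = specialize F^`() a.
Proof. by rewrite !specializeE deriv_map. Qed.

(** A monic common divisor keeps its degree under specialization. *)
Lemma coprimep_specialize F A a : F \is monic ->
  coprimep (specialize F a) (specialize A a) -> coprimep F A.
Proof.
move=> mF cop; have [d [md dF dA mx]] := monic_gcd A mF.
have sd : size d == 1.
  rewrite -(size_specialize a md) size_poly_eq1.
  by apply: (coprimepP _ _ cop) => //; apply: specialize_dvdp.
have d1 : d = 1.
  by have /size_poly1P [c _ ec] := sd; move: md; rewrite ec monicE lead_coefC => /eqP ->.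
by apply/coprimepP => d' h1 h2; rewrite /eqp -{1}d1 mx //= dvd1p.
Qed.

Lemma separable_specialize F a : F \is monic ->
  separable_poly (specialize F a) -> separable_poly F.
Proof.
rewrite !separable_poly.unlock => mF h.
by apply: (coprimep_specialize (a := a)) => //; rewrite -deriv_specialize.
Qed.

Lemma roots_finite p : p != 0 -> exists s : seq E, forall a, root p a -> a \in s.
Proof.
have [n] := ubnP (size p); elim: n p => // n IH p; rewrite ltnS => ltn p0.
have [[a ra]|nr] := EM (exists a, root p a); last first.
  by exists [::] => a ra; case: nr; exists a.
have /factor_theorem [q eq] := ra.
have q0 : q != 0 by apply: contraNneq p0 => q0; rewrite eq q0 mul0r.
have [|s hs] := IH q _ q0.
  by apply: leq_trans ltn; rewrite eq size_Mmonic ?monicXsubC // size_XsubC addn2.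
exists (a :: s) => b; rewrite eq rootM root_XsubC inE => /orP [/hs ->|->] //.
by rewrite orbT.
Qed.

(** A Bezout relation can be specialized wherever its right-hand constant does not vanish. *)
Lemma coprimep_specialize_finite F A : coprimep F A ->
  exists s : seq E, forall a, a \notin s -> coprimep (specialize F a) (specialize A a).
Proof.
case/Pdiv.Idomain.Bezout_coprimepP => [[u v] /eqpP [[c1 c2] /= /andP [h1 h2] e]].
have [s hs] := roots_finite h2.
exists s => a nas; apply/Bezout_coprimepP.
exists (c1.[a] *: specialize u a, c1.[a] *: specialize v a) => /=.
have c2a : c2.[a] != 0 by apply: contra nas; apply: hs.
apply/eqpP; exists (1, c2.[a]); rewrite /= ?oner_eq0 //.
move/(congr1 (map_poly (horner_eval a))): e.
rewrite !map_polyZ rmorphD !rmorphM rmorph1 => e.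
by rewrite scale1r -!scalerAl -scalerDr; apply: e.
Qed.

Lemma separable_specialize_finite F : separable_poly F ->
  exists s : seq E, forall a, a \notin s -> separable_poly (specialize F a).
Proof.
rewrite separable_poly.unlock => /coprimep_specialize_finite [s hs].
by exists s => a /hs; rewrite deriv_specialize.
Qed.

(** Frees the rest of the proof from the fraction field: both notions amount to a Bezout relation
    with denominators cleared. *)
Lemma separable_in_YP F : separable_in_Y F <-> separable_poly F.
Proof.
rewrite /separable_in_Y !separable_poly.unlock deriv_map.
have tofrac_neq0 (c : {poly E}) : c != 0 -> tofrac c != 0 by rewrite tofrac_eq0.
split=> [cop|].
  apply/coprimepP => d dF dF'.
  have hm A : d %| A -> map_poly (@tofrac _) d %| map_poly (@tofrac _) A.
    case/Pdiv.Idomain.dvdpP => [[c q] /= c0 e].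
    rewrite -(dvdpZr _ _ (tofrac_neq0 _ c0)).
    by rewrite -map_polyZ e rmorphM dvdp_mull.
  have := coprimepP _ _ cop _ (hm _ dF) (hm _ dF').
  rewrite -size_poly_eq1 size_map_inj_poly ?tofrac0 //; last first.
    by move=> x y /eqP; rewrite tofrac_eq => /eqP.
  by case/size_poly1P => c c0 ->; apply/eqpP; exists (1, c); rewrite /= ?oner_eq0 // scale1r alg_polyC.
case/Pdiv.Idomain.Bezout_coprimepP => [[u v] /eqpP [[c1 c2] /= /andP [h1 h2] e]].
have e' : tofrac c1 *: (map_poly (@tofrac _) u * map_poly (@tofrac _) F
     + map_poly (@tofrac _) v * map_poly (@tofrac _) F^`()) = tofrac c2 *: 1.
  rewrite -(rmorphM (map_poly (@tofrac _)) u) -(rmorphM (map_poly (@tofrac _)) v).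
  by rewrite -(rmorphD (map_poly (@tofrac _)) (u * F)) -map_polyZ e map_polyZ rmorph1.
apply/Bezout_coprimepP.
exists (map_poly (@tofrac _) u, map_poly (@tofrac _) v).
apply/eqpP; exists (tofrac c1, tofrac c2); last exact: e'.
by apply/andP; split; apply: tofrac_neq0.
Qed.

End Specialization.

(** * Automorphisms of a separable closure *)

Section Splitting.

Variable E : fieldType.
Hypothesis closedE : forall p : {poly E}, (1 < size p)%N -> separable_poly p ->
  exists x, root p x.

Lemma separable_split (p : {poly E}) : p \is monic -> separable_poly p ->
  exists2 zs, uniq zs & p = \prod_(z <- zs) ('X - z%:P).
Proof.
move=> mp sp; suff [zs e] : exists zs, p = \prod_(z <- zs) ('X - z%:P).
  by exists zs => //; rewrite -separable_prod_XsubC -e.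
have [n] := ubnP (size p); elim: n p mp sp => // n IH p mp sp; rewrite ltnS => ltn.
have [sp1|sp1] := leqP (size p) 1.
  exists [::]; rewrite big_nil; have /size_poly1P [c _ ec] : size p == 1.
    by rewrite eqn_leq sp1 size_poly_gt0 monic_neq0.
  by move: mp; rewrite ec monicE lead_coefC => /eqP ->.
have [x /factor_theorem [q eq]] := closedE sp1 sp.
have mq : q \is monic by move: mp; rewrite eq monicMr ?monicXsubC.
have [||zs ezs] := IH q mq.
- by apply: dvdp_separable sp; rewrite eq dvdp_mulr.
- by apply: leq_trans ltn; rewrite eq size_Mmonic ?monicXsubC ?monic_neq0 // size_XsubC addn2.
by exists (x :: zs); rewrite big_cons eq mulrC ezs.
Qed.

Section Extension.

Variables (k : fieldType) (iota : {rmorphism k -> E}).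
Hypothesis sepE : forall x : E, exists p : {poly k},
  [/\ p != 0, root (map_poly iota p) x & separable_poly p].
Hypothesis infk : forall s : seq E, exists t : k, iota t \notin s.
Variable enumE : nat -> E.
Hypothesis enumE_surj : forall x, exists n, enumE n = x.

Local Notation ev q x := (map_poly iota q).[x].

Lemma ev_comp q r x : ev (q \Po r) x = ev q (ev r x).
Proof. by rewrite map_comp_poly horner_comp. Qed.

Lemma minimal_poly_exists x : exists p : {poly k},
  [/\ p \is monic, separable_poly p, ev p x = 0 &
      forall q, ev q x = 0 -> p %| q].
Proof.
have ex : exists n, `[< exists p : {poly k}, [/\ p != 0, ev p x = 0 & size p = n] >].
  have [p [p0 /rootP px _]] := sepE x.
  by exists (size p); apply/asboolP; exists p.
case: (ex_minnP ex) => n /asboolP [p [p0 px sp]] min_n.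
have pdvd q : ev q x = 0 -> p %| q.
  move=> qx; apply: contraT => nd.
  have m0 : q %% p != 0 by rewrite -[_ == 0]/(p %| q).
  have /min_n : `[< exists r : {poly k}, [/\ r != 0, ev r x = 0 & size r = size (q %% p)] >].
    apply/asboolP; exists (q %% p); split=> //; move: qx.
    by rewrite {1}(divp_eq q p) rmorphD rmorphM /= hornerD hornerM px mulr0 add0r.
  by rewrite leqNgt -sp ltn_modp p0.
have lp : lead_coef p != 0 by rewrite lead_coef_eq0.
have eqp : ((lead_coef p)^-1 *: p) %= p by rewrite eqp_scale ?invr_eq0.
exists ((lead_coef p)^-1 *: p); split.
- by rewrite monicE lead_coefZ mulVf.
- have [p' [p'0 /rootP p'x sp']] := sepE x.
  by apply: dvdp_separable sp'; rewrite (eqp_dvdl _ eqp); apply: pdvd.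
- by rewrite map_polyZ hornerZ px mulr0.
by move=> q /pdvd; rewrite (eqp_dvdl _ eqp).
Qed.

(** One step in extending an isomorphism: the embedding k(t1) -> k(t1') is prolonged to k(t2), which
    contains t1. *)
Lemma lift_root t1 t2 t1' r p1 p2 :
  t1 = ev r t2 -> (forall q, ev q t1 = 0 -> p1 %| q) -> ev p1 t1' = 0 ->
  p2 \is monic -> separable_poly p2 -> ev p2 t2 = 0 ->
  exists2 t2', ev p2 t2' = 0 & t1' = ev r t2'.
Proof.
move=> e1 min1 p1t1' m2 s2 p2t2.
have [||zs uz ez] := @separable_split (map_poly iota p2).
- exact: monic_map.
- by rewrite separable_map.
have t2zs : t2 \in zs.
  by rewrite -root_prod_XsubC -ez; apply/rootP.
case: (posnP (size zs)) => [/size0nil z0|]; first by move: t2zs; rewrite z0.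
case sz: (size zs) => [//|n] _.
(* [D] is the norm of ['X - r(t2)]: it vanishes at [t1], hence at [t1']. *)
pose D := \det (horner_mx (companion n (map_poly polyC p2))
                          ('X%:P - map_poly polyC r)).
have eD : map_poly iota D = \prod_(z <- zs) ('X - (ev r z)%:P).
  rewrite /D -det_map_mx map_horner_mx map_companion.
  have e p : map_poly (map_poly iota) (map_poly polyC p) = map_poly polyC (map_poly iota p).
    by rewrite -!map_poly_comp; apply: eq_map_poly => c /=; rewrite map_polyC.
  rewrite e ez rmorph_prod /=.
  under eq_bigr => z _ do rewrite rmorphB /= map_polyX map_polyC /=.
  rewrite -(big_map (@polyC E) xpredT (fun z => 'X - z%:P)).
  rewrite det_horner_companion ?size_map ?(map_inj_uniq (@polyC_inj _)) //.
  rewrite big_map; apply: eq_bigr => z _.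
  rewrite rmorphB /= e map_polyC /= map_polyX hornerD hornerC hornerN.
  by rewrite horner_map.
have D1 : ev D t1 = 0.
  apply/rootP; rewrite eD e1 -(big_map (fun z => ev r z) xpredT (fun z => 'X - z%:P)).
  by rewrite root_prod_XsubC map_f.
have /dvdpP [q eq] := min1 _ D1.
have : root (map_poly iota D) t1'.
  by apply/rootP; rewrite eq rmorphM /= hornerM p1t1' mulr0.
rewrite eD -(big_map (fun z => ev r z) xpredT (fun z => 'X - z%:P)).
rewrite root_prod_XsubC => /mapP [z zzs ->]; exists z => //.
by apply/rootP; rewrite ez root_prod_XsubC.
Qed.

Lemma primitive_pair x y : exists z r q, x = ev r z /\ y = ev q z.
Proof.
have [p [/monic_neq0 p0 _ /rootP px _]] := minimal_poly_exists x.
have [q [_ sq /rootP qy _]] := minimal_poly_exists y.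
have [r r0 hr] := large_field_PET p0 px qy sq.
have [s hs] := roots_finite r0; have [t ht] := infk s.
have [|[q1 e1] [q2 e2]] := hr t; first by apply: contra ht => /hs.
by exists (iota t * y - x), q1, q2.
Qed.

(** [E] is exhausted by a tower of simple extensions k(t_m), each absorbing one more term of
    [enumE]; compatible conjugates t'_m of the generators define the automorphism. *)
Lemma extend_conjugate x x' (p : {poly k}) :
  (forall q, ev q x = 0 -> p %| q) -> ev p x' = 0 ->
  exists s : {rmorphism E -> E},
    [/\ bijective s, forall c, s (iota c) = iota c & s x = x'].
Proof.
move=> pmin px'.
have /choice [mp mpP] := minimal_poly_exists.
have mp_dvd q z : ev q z = 0 -> mp z %| q by case: (mpP z) => _ _ _; apply.
(* A pair in [T] encodes the embedding k(t) -> k(t') sending t to t'. *)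
pose T := {tt : E * E | ev (mp tt.1) tt.2 = 0}.
have t0P : ev (mp (x, x').1) (x, x').2 = 0.
  rewrite /=; have /dvdpP [q ->] : p %| mp x by apply: pmin; case: (mpP x).
  by rewrite rmorphM /= hornerM px' mulr0.
pose t0 : T := exist _ (x, x') t0P.
have step (nt : nat * T) : exists t2 : T, exists r q,
    [/\ (sval nt.2).1 = ev r (sval t2).1, (sval nt.2).2 = ev r (sval t2).2
      & enumE nt.1 = ev q (sval t2).1].
  case: nt => n [[t t'] /= tt'].
  have [z [r [q [e1 e2]]]] := primitive_pair t (enumE n).
  have [m2 s2 r2 _] := mpP z.
  have [z' h1 h2] := lift_root e1 (fun q => @mp_dvd q t) tt' m2 s2 r2.
  by exists (exist _ (z, z') h1), r, q.
have {step} /choice [f fP] := step.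
pose fix ch n : T := if n is m.+1 then f (m, ch m) else t0.
have mono n m : (n <= m)%N -> exists r, (sval (ch n)).1 = ev r (sval (ch m)).1
    /\ (sval (ch n)).2 = ev r (sval (ch m)).2.
  move=> /subnKC <-; elim: (m - n)%N => [|d [r [IH1 IH2]]].
    by exists 'X; rewrite addn0 map_polyX !hornerX.
  have [r' [q [/= e1 e2 _]]] := fP ((n + d)%N, ch (n + d)%N).
  by exists (r \Po r'); rewrite !ev_comp addnS /= -e1 -e2.
pose Rl y y' := exists n q, y = ev q (sval (ch n)).1 /\ y' = ev q (sval (ch n)).2.
have common y y' z z' : Rl y y' -> Rl z z' -> exists n q1 q2,
   [/\ y = ev q1 (sval (ch n)).1, y' = ev q1 (sval (ch n)).2,
       z = ev q2 (sval (ch n)).1 & z' = ev q2 (sval (ch n)).2].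
  move=> [n [q1 [e1 e2]]] [m [q2 [e3 e4]]].
  have [r [h1 h2]] := mono _ _ (leq_maxl n m).
  have [r' [h3 h4]] := mono _ _ (leq_maxr n m).
  exists (maxn n m), (q1 \Po r), (q2 \Po r').
  by rewrite !ev_comp -h1 -h2 -h3 -h4.
(* Two expressions for y in t_n differ by a multiple of the minimal polynomial of t_n, which also
   vanishes at t'_n. *)
have Rfun y y' y'' : Rl y y' -> Rl y y'' -> y' = y''.
  move=> R1 R2; have [n [q1 [q2 [e1 -> e2 ->]]]] := common _ _ _ _ R1 R2.
  have : mp (sval (ch n)).1 %| q1 - q2.
    by apply: mp_dvd; rewrite rmorphB /= hornerD hornerN -e1 -e2 subrr.
  case/dvdpP => q /(congr1 (fun q => ev q (sval (ch n)).2)).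
  rewrite rmorphM rmorphB /= hornerD hornerN hornerM.
  by case: (ch n) => tt /= ->; rewrite mulr0 => /eqP; rewrite subr_eq0 => /eqP.
have Rtot y : exists y', Rl y y'.
  have [n <-] := enumE_surj y; have [r [q [_ _ /= e]]] := fP (n, ch n).
  by exists (ev q (sval (ch n.+1)).2), n.+1, q.
have /choice [s sP] := Rtot.
have sE y y' : Rl y y' -> s y = y' by move=> h; apply: Rfun h.
have sB : {morph s : y z / y - z}.
  move=> y z; apply: sE; have [n [q1 [q2 [e1 e2 e3 e4]]]] := common _ _ _ _ (sP y) (sP z).
  exists n, (q1 - q2); rewrite rmorphB /= !hornerD !hornerN.
  by rewrite -e1 -e2 -e3 -e4.
have sM : {morph s : y z / y * z}.
  move=> y z; apply: sE; have [n [q1 [q2 [e1 e2 e3 e4]]]] := common _ _ _ _ (sP y) (sP z).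
  by exists n, (q1 * q2); rewrite rmorphM /= !hornerM -e1 -e2 -e3 -e4.
have sc c : s (iota c) = iota c.
  by apply: sE; exists 0, c%:P; rewrite map_polyC !hornerC.
have s1 : s 1 = 1 by rewrite -(rmorph1 iota) sc.
pose sadd := GRing.isZmodMorphism.Build E E s sB.
pose smul := GRing.isMonoidMorphism.Build E E s (s1, sM).
pose sr : {rmorphism E -> E} := HB.pack s sadd smul.
exists sr; split=> //; last first.
  by apply: sE; exists 0, 'X; rewrite map_polyX !hornerX.
have inj : injective sr by apply: fmorph_inj.
(* An injective map permutes the finitely many roots of the minimal polynomial of y. *)
have surj y : exists z, s z = y.
  have [m sp /rootP py _] := mpP y.
  have [||zs uz ez] := @separable_split (map_poly iota (mp y)).
  - exact: monic_map.
  - by rewrite separable_map.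
  have ms : {subset map sr zs <= zs}.
    move=> _ /mapP [z zzs ->]; move: zzs; rewrite -!root_prod_XsubC -ez => /rootP rz.
    have e : map_poly sr (map_poly iota (mp y)) = map_poly iota (mp y).
      by apply/polyP => i; rewrite !coef_map /= sc.
    by apply/rootP; rewrite -e horner_map rz rmorph0.
  have usz : uniq (map sr zs) by rewrite map_inj_uniq.
  have lsz : (size zs <= size (map sr zs))%N by rewrite size_map.
  have [_ eqi] := uniq_min_size usz ms lsz.
  have : y \in map sr zs.
    by rewrite eqi -root_prod_XsubC -ez.
  by case/mapP => z _ ->; exists z.
have /choice [g gP] := surj.
by exists g => y //; apply: inj; rewrite /= gP.
Qed.

End Extension.
End Splitting.

(** * Subfields as field types, automorphism groups and fixed fields *)

Section SubfieldType.

Variables (E : fieldType) (F : E -> Prop).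
Hypothesis subF : is_subfield F.

(** The proof of [is_subfield F] is an argument so that the instances below can be attached to
    it. *)
Definition subfield_mem of is_subfield F : {pred E} := fun x => `[< F x >].

Lemma subfield_memP x : reflect (F x) (x \in subfield_mem subF).
Proof. exact: asboolP. Qed.

Lemma subfield_divring_closed : divring_closed (subfield_mem subF).
Proof.
have [F0 F1 FBM FV] := subF; split.
- exact/subfield_memP.
- move=> x y /subfield_memP Fx /subfield_memP Fy.
  by apply/subfield_memP; case: (FBM x y Fx Fy).
move=> x y /subfield_memP Fx /subfield_memP Fy.
by apply/subfield_memP; case: (FBM x _ Fx (FV _ Fy)).
Qed.

HB.instance Definition _ :=
  GRing.isDivringClosed.Build E (subfield_mem subF) subfield_divring_closed.

Record subfield_type := SubfieldType
  { subfield_val : E; _ : subfield_val \in subfield_mem subF }.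

HB.instance Definition _ := [isSub for subfield_val].
HB.instance Definition _ := [Choice of subfield_type by <:].
HB.instance Definition _ := [SubChoice_isSubIntegralDomain of subfield_type by <:].
HB.instance Definition _ := [SubIntegralDomain_isSubField of subfield_type by <:].

Lemma subfield_lift x : F x -> exists y : subfield_type, val y = x.
Proof. by move/subfield_memP => Fx; exists (SubfieldType Fx). Qed.

Lemma subfield_valP (y : subfield_type) : F (val y).
Proof. exact/subfield_memP/(valP y). Qed.

Lemma poly_over_lift p : poly_over F p ->
  exists q : {poly subfield_type}, map_poly val q = p.
Proof.
move=> Fp; have /choice [f fP] i := subfield_lift (Fp i).
exists (\poly_(i < size p) f i); apply/polyP => i.
rewrite coef_map coef_poly; case: ltnP => [_|si]; first exact: fP.
by rewrite nth_default ?rmorph0.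
Qed.

End SubfieldType.

Section Automorphisms.

Variable E : fieldType.
Implicit Types (K F : E -> Prop) (s t : {rmorphism E -> E}).

Lemma Kaut_rmorphism K (s : E -> E) : Kaut K s ->
  exists s' : {rmorphism E -> E}, s = s' :> (E -> E).
Proof.
case=> sD sM s1 _ _.
have sB : {morph s : x y / x - y}.
  move=> x y; have s0 : s 0 = 0 by apply: (addIr (s 0)); rewrite -sD !add0r.
  by apply: (addIr (s y)); rewrite -sD !subrK.
pose sadd := GRing.isZmodMorphism.Build E E s sB.
pose smul := GRing.isMonoidMorphism.Build E E s (s1, sM).
pose sr : {rmorphism E -> E} := HB.pack s sadd smul.
by exists sr.
Qed.

Lemma KautP K s : (forall x, K x -> s x = x) -> bijective s -> Kaut K s.
Proof. by split=> //; [exact: rmorphD|exact: rmorphM|exact: rmorph1]. Qed.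

Lemma Kaut_id K : Kaut K id.
Proof. by split=> //; exists id. Qed.

Lemma Kaut_comp K (s t : E -> E) : Kaut K s -> Kaut K t -> Kaut K (s \o t).
Proof.
case=> sD sM s1 sb sK [tD tM t1 tb tK]; split=> /=.
- by move=> x y /=; rewrite tD sD.
- by move=> x y /=; rewrite tM sM.
- by rewrite t1.
- exact: bij_comp.
by move=> x Kx /=; rewrite tK ?sK.
Qed.

Lemma Kaut_inv K (s : E -> E) : Kaut K s ->
  exists2 t, Kaut K t & cancel s t /\ cancel t s.
Proof.
case=> sD sM s1 [t st ts] sK; exists t => //; have inj := can_inj st; split.
- by move=> x y; apply: inj; rewrite sD !ts.
- by move=> x y; apply: inj; rewrite sM !ts.
- by apply: inj; rewrite s1 ts.
- by exists s.
by move=> x Kx; apply: inj; rewrite ts sK.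
Qed.

Lemma Kaut_sub K F (s : E -> E) : (forall x, K x -> F x) -> Kaut F s -> Kaut K s.
Proof. by move=> KF [? ? ? ? h]; split=> // x /KF/h. Qed.

Definition infinite_pred F := forall s : seq E, exists2 a, F a & a \notin s.

Lemma sep_closure_sub K F : (forall x, K x -> F x) -> sep_closure K -> sep_closure F.
Proof.
move=> KF [h1 h2]; split=> // x; have [p [Kp ? ? ?]] := h1 x.
by exists p; split=> // i; apply: KF.
Qed.

(** An element is coded by the indices of the coefficients of an equation for it and by its place in
    a chosen list of roots. *)
Lemma countable_closure K : countable_pred K -> sep_closure K ->
  exists en : nat -> E, forall x, exists n, en n = x.
Proof.
move=> [f fK] [sepK _].
have rts (p : {poly E}) : exists s : seq E, p != 0 -> forall a, root p a -> a \in s.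
  have [->|p0] := eqVneq p 0; first by exists [::].
  by have [s hs] := roots_finite p0; exists s.
have {rts} /choice [rl rlP] := rts.
exists (fun n => if unpickle n is Some (ns, i) then
   nth 0 (rl (Poly (map f ns))) i else 0) => x.
have [p [Kp p0 px _]] := sepK x.
have /choice [g gP] i := fK _ (Kp i).
exists (pickle (mkseq g (size p), index x (rl p))); rewrite pickleK.
have -> : Poly (map f (mkseq g (size p))) = p.
  apply/polyP => i; rewrite coef_Poly.
  have [lti|gei] := ltnP i (size p).
    by rewrite (nth_map 0%N) ?size_mkseq // nth_mkseq // gP.
  by rewrite [RHS]nth_default // [LHS]nth_default // size_map size_mkseq.
by rewrite nth_index ?rlP.
Qed.

Section FixedField.

Variable F : E -> Prop.
Hypotheses (subF : is_subfield F) (sepF : sep_closure F) (infF : infinite_pred F).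
Variable en : nat -> E.
Hypothesis en_surj : forall x, exists n, en n = x.

(** All roots of the minimal polynomial of x are images of x, so it has the single root x and degree
    1. *)
Lemma fixed_field x : (forall s, Kaut F s -> s x = x) -> F x.
Proof.
move=> fx; pose k : fieldType := subfield_type subF.
pose iota : {rmorphism k -> E} := val.
have sepE y : exists p : {poly k}, [/\ p != 0, root (map_poly iota p) y & separable_poly p].
  have [p [Fp p0 py sp]] := sepF.1 y; have [q eq] := poly_over_lift subF Fp.
  exists q; rewrite -(separable_map iota) eq; split=> //.
  by apply: contraNneq p0 => q0; rewrite -eq q0 map_poly0.
have infk (s : seq E) : exists t : k, iota t \notin s.
  have [a Fa nas] := infF s; have [t et] := subfield_lift subF Fa.
  by exists t; move: nas; rewrite -et.
have closedE := sepF.2.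
have [p [mp sp px pmin]] := minimal_poly_exists sepE x.
have [||zs uz ez] := @separable_split _ closedE (map_poly iota p).
- exact: monic_map.
- by rewrite separable_map.
have xz : x \in zs by rewrite -root_prod_XsubC -ez; apply/rootP.
have zx z : z \in zs -> z = x.
  rewrite -root_prod_XsubC -ez => /rootP zr.
  have [s [sb sF <-]] := extend_conjugate closedE sepE infk en_surj pmin zr.
  apply: fx; apply: KautP => // y Fy.
  by have [c <-] := subfield_lift subF Fy; apply: sF.
have zs1 : zs = [:: x].
  apply: perm_small_eq => //; apply: uniq_perm => // z.
  by rewrite inE; apply/idP/eqP => [/zx|->].
have : iota (- p`_0) = x.
  have e0 : iota p`_0 = (map_poly iota p)`_0 by rewrite coef_map.
  by rewrite rmorphN e0 ez zs1 big_seq1 coefB coefX coefC sub0r opprK.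
by move=> <-; apply: subfield_valP.
Qed.

End FixedField.

End Automorphisms.

(** * Orbits, primitive elements and descent to K *)

Lemma map_uniq_inj (T1 T2 : eqType) (f : T1 -> T2) (s : seq T1) :
  uniq (map f s) -> {in s &, injective f}.
Proof.
move=> us x y xs ys fxy; rewrite -(nth_index x xs) -(nth_index x ys).
congr (nth _ _ _); apply/eqP.
rewrite -(nth_uniq (f x) _ _ us) ?size_map ?index_mem //.
by rewrite !(nth_map x) ?index_mem // !nth_index // fxy.
Qed.

Lemma exists_filter (T : eqType) (s : seq T) (P : T -> Prop) :
  exists o : seq T, uniq o /\ forall y, y \in o <-> y \in s /\ P y.
Proof.
exists [seq y <- undup s | `[< P y >]]; split=> [|y].
  by rewrite filter_uniq ?undup_uniq.
rewrite mem_filter mem_undup; split=> [/andP[/asboolP Py ->] //|[-> Py]].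
by rewrite andbT; apply/asboolP.
Qed.

Lemma interpolation (E : fieldType) (zs : seq E) (f : E -> E) : uniq zs ->
  exists q : {poly E}, (size q <= size zs)%N /\ {in zs, forall z, q.[z] = f z}.
Proof.
elim: zs => [_|z zs IH /= /andP [nz /IH [q [sq qf]]]].
  by exists 0; rewrite size_poly0.
pose P := \prod_(y <- zs) ('X - y%:P).
have Pz : P.[z] != 0 by rewrite -[_ == 0]/(root P z) root_prod_XsubC.
exists (q + ((f z - q.[z]) / P.[z]) *: P); split.
  apply: leq_trans (size_polyD _ _) _; rewrite geq_max (leq_trans sq) //=.
  by apply: leq_trans (size_scale_leq _ _) _; rewrite size_prod_XsubC.
move=> y; rewrite inE hornerD hornerZ => /orP [/eqP ->|yzs].
  by rewrite divfK // addrC subrK.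
by rewrite (_ : P.[y] = 0) ?mulr0 ?addr0 ?qf //; apply/rootP; rewrite root_prod_XsubC.
Qed.

Lemma interpolation_unique (E : fieldType) (zs : seq E) (q1 q2 : {poly E}) :
  uniq zs -> (size q1 <= size zs)%N -> (size q2 <= size zs)%N ->
  {in zs, forall z, q1.[z] = q2.[z]} -> q1 = q2.
Proof.
move=> uz s1 s2 e; apply/eqP; rewrite -subr_eq0; apply: contraT => d0.
have := max_poly_roots d0 _ uz; rewrite ltnNge => /(_ _)/negP [].
  by apply/allP => z zzs; apply/rootP; rewrite hornerD hornerN e // subrr.
by apply: leq_trans (size_polyD _ _) _; rewrite size_polyN geq_max s1.
Qed.

Definition act (E : fieldType) (s : {rmorphism E -> E}) (f : {poly {poly E}}) :=
  map_poly (map_poly s) f.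

(** These are the properties of K that pass to L ([base_ext]), so the Galois theory below serves
    both fields. *)
Record galois_base (E : fieldType) (K : E -> Prop) : Prop := GaloisBase {
  base_subfield : is_subfield K;
  base_sep_closure : sep_closure K;
  base_infinite : infinite_pred K;
  base_enum : exists en : nat -> E, forall x, exists n, en n = x }.

Section GaloisBase.

Variables (E : fieldType) (K : E -> Prop).
Hypothesis baseK : galois_base K.
Implicit Types (s t : {rmorphism E -> E}) (x y z th : E) (p q : {poly E}).
Implicit Types (F A B : {poly {poly E}}).

Lemma base_fixed x : (forall s, Kaut K s -> s x = x) -> K x.
Proof.
by have [en hen] := base_enum baseK; apply: fixed_field hen x; apply baseK.
Qed.

Lemma base_split p : p \is monic -> separable_poly p ->
  exists2 zs, uniq zs & p = \prod_(z <- zs) ('X - z%:P).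
Proof. by apply: separable_split; case: (base_sep_closure baseK). Qed.

Lemma gal_inv s : Kaut K s ->
  exists t, [/\ Kaut K t, cancel s t & cancel t s].
Proof.
move=> /Kaut_inv [t tK [st ts]]; have [t' e] := Kaut_rmorphism tK.
by exists t'; rewrite -e.
Qed.

Lemma gal_comp s t : Kaut K s -> Kaut K t ->
  exists u : {rmorphism E -> E}, Kaut K u /\ forall x, u x = s (t x).
Proof.
move=> sK tK; have [u e] := Kaut_rmorphism (Kaut_comp sK tK).
by exists u; rewrite -e; split=> //; apply: Kaut_comp.
Qed.

Lemma gal_fix s x : Kaut K s -> K x -> s x = x.
Proof. by case=> _ _ _ _; apply. Qed.

Lemma conj_finite x : exists o : seq E, forall s, Kaut K s -> s x \in o.
Proof.
have [p [Kp p0 px _]] := (base_sep_closure baseK).1 x.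
have [o ho] := roots_finite p0; exists o => s sK; apply: ho; apply/rootP.
have e : map_poly s p = p.
  by apply/polyP => i; rewrite coef_map /= (gal_fix sK).
by rewrite -e horner_map (rootP px) rmorph0.
Qed.

Lemma orbit_exists (P : {rmorphism E -> E} -> Prop) x :
  (forall s, P s -> Kaut K s) ->
  exists o : seq E, uniq o /\ forall y, y \in o <-> exists2 s, P s & s x = y.
Proof.
move=> PK; have [o ho] := conj_finite x.
have [o' [uo ho']] := exists_filter o (fun y => exists2 s, P s & s x = y).
exists o'; split=> // y; split=> [/ho' []//|Py]; apply/ho'; split=> //.
by case: Py => s /PK/ho h <-.
Qed.

(** Two distinct pairs have equal combinations for at most one c. This is the tool for encoding
    several elements in one. *)
Lemma separating_coef (ps : seq (E * E)) (bad : seq E) : uniq ps ->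
  exists c, [/\ K c, c \notin bad & uniq [seq u.1 + c * u.2 | u <- ps]].
Proof.
move=> ups.
have [c Kc] := base_infinite baseK (bad ++ [seq (u.1 - v.1) / (v.2 - u.2) | u <- ps, v <- ps]).
rewrite mem_cat negb_or => /andP [nb nc].
exists c; split=> //; rewrite map_inj_in_uniq // => u v us vs e.
have [e2|ne] := eqVneq u.2 v.2.
  by move: e; rewrite e2 => /addIr e1; case: u v e1 e2 {us vs} => ? ? [? ?] /= -> ->.
case/negP: nc; apply/allpairsP; exists (u, v); split=> //=.
have d0 : v.2 - u.2 != 0 by rewrite subr_eq0 eq_sym.
apply: (mulIf d0); rewrite divfK // mulrBr; apply: (addrI v.1).
by rewrite addrA -e addrK addrC subrK.
Qed.

Definition fixes s (xs : seq E) := {in xs, forall x, s x = x}.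

(** Finite extensions of K never appear as fields: each is represented by an element [th] with the
    right stabilizer. *)
Lemma primitive_list (xs : seq E) :
  exists th, forall s, Kaut K s -> s th = th <-> fixes s xs.
Proof.
elim: xs => [|x xs [th IH]].
  by exists 0 => s _; split=> // _; apply: rmorph0.
have [o1 [u1 h1]] := orbit_exists x (fun s (h : Kaut K s) => h).
have [o2 [u2 h2]] := orbit_exists th (fun s (h : Kaut K s) => h).
have ups : uniq [seq (a, b) | a <- o1, b <- o2] by apply: allpairs_uniq => // -[? ?] [? ?] _ _ [-> ->].
have [c [Kc _ uc]] := separating_coef [::] ups.
have mem s : Kaut K s -> (s x, s th) \in [seq (a, b) | a <- o1, b <- o2].
  by move=> sK; apply/allpairsP; exists (s x, s th); split=> //=; [apply/h1|apply/h2]; exists s.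
exists (x + c * th) => s sK; rewrite rmorphD rmorphM /= (gal_fix sK Kc); split=> [e|fx].
  have h := map_uniq_inj uc (mem s sK).
  have [id' [idK ide]] : exists t, Kaut K t /\ forall y, t y = y.
    by exists idfun; split=> //; apply: Kaut_id.
  have := mem _ idK; rewrite !ide => /h/(_ e) [e1 /(IH _ sK) e2].
  by move=> y; rewrite inE => /orP [/eqP -> //|/e2].
rewrite fx ?mem_head // (IH s sK).2 // => y ys; by apply: fx; rewrite inE ys orbT.
Qed.

(** In field terms, K(th)/K is Galois. *)
Definition normal_elt th := forall s t, Kaut K s -> Kaut K t -> s th = th -> s (t th) = t th.

Lemma normal_primitive (xs : seq E) :
  exists2 th, normal_elt th & forall s, Kaut K s -> s th = th -> fixes s xs.
Proof.
have [O [sub cl]] : exists O : seq E,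
    {subset xs <= O} /\ forall x s, Kaut K s -> x \in O -> s x \in O.
  elim: xs => [|x xs [O [sub cl]]]; first by exists [::]; split.
  have [o [uo ho]] := orbit_exists x (fun s (h : Kaut K s) => h).
  exists (o ++ O); split=> [y|y s sK].
    rewrite inE mem_cat => /orP [/eqP ->|/sub ->]; last by rewrite orbT.
    by apply/orP; left; apply/ho; exists idfun => //; apply: Kaut_id.
  rewrite !mem_cat => /orP [/ho [t tK <-]|yO]; last by rewrite cl ?orbT.
  by have [u [uK eu]] := gal_comp sK tK; apply/orP; left; apply/ho; exists u.
have [th hth] := primitive_list O.
exists th => [s t sK tK sth|s sK /hth fO x /sub]; last by apply: fO.
have [t' [t'K tt' t't]] := gal_inv tK.
have [u [uK eu]] := gal_comp sK tK; have [v [vK ev]] := gal_comp t'K uK.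
have : v th = th.
  apply/hth => // x xO; rewrite ev eu (hth s sK).1 ?tt' //; exact: cl.
by rewrite ev eu => /(congr1 t); rewrite t't.
Qed.

(** The polynomial interpolating the conjugates of b at those of th is unique in its degree range,
    hence Galois invariant, hence over K. *)
Lemma poly_in_primitive th b : (forall s, Kaut K s -> s th = th -> s b = b) ->
  exists2 q, poly_over K q & q.[th] = b.
Proof.
move=> fb; have [o [uo ho]] := orbit_exists th (fun s (h : Kaut K s) => h).
have ht y : exists s, y \in o -> Kaut K s /\ s th = y.
  have [/ho [s sK e]|ny] := boolP (y \in o); first by exists s.
  by exists idfun.
have {ht} /choice [tau tauP] := ht.
have [q [sq qP]] := interpolation (fun y => tau y b) uo.
have tho : th \in o by apply/ho; exists idfun => //; apply: Kaut_id.
have tau_eq s y : Kaut K s -> y \in o -> tau (s y) b = s (tau y b).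
  move=> sK yo; have [tK ty] := tauP _ yo.
  have [u [uK eu]] := gal_comp sK tK.
  have syo : s y \in o by apply/ho; exists u; rewrite ?eu ?ty.
  have [t'K t'y] := tauP _ syo; have [v [vK tv vt]] := gal_inv t'K.
  have [w [wK ew]] := gal_comp vK uK.
  have : w b = b by apply: fb => //; rewrite ew eu ty -t'y tv.
  by rewrite ew eu => /(congr1 (tau (s y))); rewrite vt => ->.
exists q; last first.
  rewrite qP //; apply: fb; by have [] := tauP _ tho.
move=> i; apply: base_fixed => s sK.
suff /polyP/(_ i) : map_poly s q = q by rewrite coef_map.
apply: (@interpolation_unique _ o) => //; first by rewrite size_map_poly.
move=> y yo; have [s' [s'K ss' s's]] := gal_inv sK.
have s'yo : s' y \in o.
  have [t tK ty] := (ho _).1 yo; have [u [uK eu]] := gal_comp s'K tK.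
  by apply/ho; exists u; rewrite ?eu ?ty.
by rewrite -{1}(s's y) horner_map /= !qP // -tau_eq // s's.
Qed.

Lemma act_specialize s F a : specialize (act s F) (s a) = map_poly s (specialize F a).
Proof.
apply/polyP => i; rewrite coef_map /= !coef_specialize coef_map /=.
by rewrite horner_map.
Qed.

Lemma act_monic s F : F \is monic -> act s F \is monic.
Proof. exact: monic_map. Qed.

Lemma size_act s F : size (act s F) = size F.
Proof.
apply: size_map_inj_poly; last exact: rmorph0.
by move=> p q /map_poly_inj.
Qed.

Lemma actM s F A : act s (F * A) = act s F * act s A.
Proof. exact: rmorphM. Qed.

Lemma act_comp s t (u : {rmorphism E -> E}) F : (forall x, u x = s (t x)) -> act u F = act s (act t F).
Proof.
move=> eu; apply/polyP => i; rewrite !coef_map /=.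
by apply/polyP => j; rewrite !coef_map /= eu.
Qed.

Lemma act_id t F : (forall x, t x = x) -> act t F = F.
Proof.
move=> et; apply/polyP => i; rewrite !coef_map /=.
by apply/polyP => j; rewrite !coef_map /= et.
Qed.

Lemma act_dvdp s F A : F \is monic -> F %| A -> act s F %| act s A.
Proof.
by move=> mF /(Pdiv.IdomainMonic.dvdpP mF) [q ->]; rewrite actM dvdp_mull.
Qed.

(** In field terms, the coefficients of [F] lie in K(th). *)
Definition stable th F := forall s, Kaut K s -> s th = th -> act s F = F.

Lemma act_stable th F s t : stable th F -> Kaut K s -> Kaut K t -> s th = t th ->
  act s F = act t F.
Proof.
move=> fF sK tK e; have [t' [t'K tt' t't]] := gal_inv tK.
have [u [uK eu]] := gal_comp t'K sK.
have eF : act u F = F by apply: fF => //; rewrite eu e tt'.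
by rewrite -{2}eF -(act_comp (u := s)) // => x; rewrite eu t't.
Qed.

Definition stable_irreducible th F := [/\ F \is monic, (1 < size F)%N, stable th F &
  forall A B, A \is monic -> B \is monic -> stable th A -> stable th B ->
    F = A * B -> size A = 1 \/ size B = 1].

Lemma monic_size1 (R : nzRingType) (p : {poly R}) : p \is monic -> size p = 1 -> p = 1.
Proof.
move=> mp sp; have e : p = (p`_0)%:P by apply: size1_polyC; rewrite sp.
by move: mp; rewrite e monicE lead_coefC => /eqP ->.
Qed.

(** The monic gcd of [F] and [A] is stable, because automorphisms fixing th preserve the common
    divisors; irreducibility leaves only 1 and [F]. *)
Lemma stable_prime th F A B : stable_irreducible th F -> stable th A ->
  F %| A * B -> F %| A \/ F %| B.
Proof.
move=> [mF sF fF irr] fA FAB.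
have [d [md dF dA dmax]] := monic_gcd A mF.
have fd : stable th d.
  move=> s sK sth; apply/eqP; rewrite -eqp_monic ?act_monic // -dvdp_size_eqp.
    by rewrite size_act.
  by apply: dmax; [rewrite -(fF s)|rewrite -(fA s)] => //; apply: act_dvdp.
have /(Pdiv.IdomainMonic.dvdpP md) [q eF] := dF.
have mq : q \is monic by move: mF; rewrite eF monicMr.
have fq : stable th q.
  move=> s sK sth; apply: (mulIf (monic_neq0 md)).
  by rewrite -{1}(fd s) // -actM -eF fF.
have [s1|s1] := irr q d mq md fq fd eF.
  by left; rewrite eF (monic_size1 mq s1) mul1r.
right; rewrite -(@Gauss_dvdpr _ B A F) //.
apply/coprimepP => d' h1 h2; rewrite /eqp dvd1p andbT.
by rewrite -(monic_size1 md s1) dmax.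
Qed.

(** The product of X - y over the orbit of v is invariant, so it is a factor of p over K, and it is
    not constant. *)
Lemma irreducible_transitive p v w : uni_irreducible K p -> p \is monic ->
  separable_poly p -> root p v -> root p w ->
  exists2 s : {rmorphism E -> E}, Kaut K s & s v = w.
Proof.
move=> [Kp sp irr] mp sepp pv pw.
have [o [uo ho]] := orbit_exists v (fun s (h : Kaut K s) => h).
have psK s : Kaut K s -> map_poly s p = p.
  by move=> sK; apply/polyP => i; rewrite coef_map /= (gal_fix sK).
have oroot : all (root p) o.
  apply/allP => y /ho [s sK <-]; apply/rootP.
  by rewrite -(psK s sK) horner_map (rootP pv) rmorph0.
have uro : uniq_roots o by rewrite uniq_rootsE.
have [q eq] := uniq_roots_prod_XsubC oroot uro.
pose O := \prod_(z <- o) ('X - z%:P).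
have mO : O \is monic by apply: monic_prod_XsubC.
have OK s : Kaut K s -> map_poly s O = O.
  move=> sK; rewrite rmorph_prod /=.
  under eq_bigr => z _ do rewrite rmorphB /= map_polyX map_polyC /=.
  rewrite -(big_map s xpredT (fun z => 'X - z%:P)); apply: perm_big.
  have uso : uniq (map s o) by rewrite map_inj_uniq //; apply: fmorph_inj.
  apply: uniq_perm => //.
  have sub : {subset map s o <= o}.
    move=> _ /mapP [y /ho [t tK <-] ->].
    by have [u [uK eu]] := gal_comp sK tK; apply/ho; exists u.
  by have [] := uniq_min_size uso sub; rewrite ?size_map.
have Oover : poly_over K O.
  by move=> i; apply: base_fixed => s /OK/polyP/(_ i); rewrite coef_map.
have qover : poly_over K q.
  move=> i; apply: base_fixed => s sK.
  suff /polyP/(_ i) : map_poly s q = q by rewrite coef_map.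
  by apply: (mulIf (monic_neq0 mO)); rewrite -{1}(OK s sK) -rmorphM /= -eq psK.
have vo : v \in o by apply/ho; exists idfun => //; apply: Kaut_id.
have [s1|s1] := irr q O qover Oover eq; last first.
  move: s1; rewrite size_prod_XsubC => -[] /size0nil o0.
  by move: vo; rewrite o0.
have mq : q \is monic by move: mp; rewrite eq monicMr.
apply: (ho w).1; rewrite -root_prod_XsubC -/O.
by move: pw; rewrite eq (monic_size1 mq s1) mul1r.
Qed.

End GaloisBase.

(** * Hilbert irreducibility over finite extensions *)

Section HilbertianBase.

Variables (E : fieldType) (K : E -> Prop).
Hypothesis subK : is_subfield K.

Lemma bi_unit_lead (g h : {poly {poly E}}) :
  lead_coef g * lead_coef h = 1 -> size g = 1 -> bi_unit g.
Proof.
move=> e sg; split=> //; have eg : g = (g`_0)%:P by apply: size1_polyC; rewrite sg.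
move: e; rewrite eg lead_coefC coefC eqxx => e.
have : g`_0 \is a GRing.unit by apply/unitrP; exists (lead_coef h); rewrite mulrC e.
by rewrite poly_unitE => /andP [/eqP ->].
Qed.

(** In a factorization of a monic polynomial the leading coefficients are units, that is, constants
    of K, and can be scaled to 1. *)
Lemma bi_irreducible_monic (f : {poly {poly E}}) :
  f \is monic -> (1 < size f)%N -> bi_over K f ->
  (forall A B : {poly {poly E}}, A \is monic -> B \is monic -> bi_over K A ->
     bi_over K B -> f = A * B -> size A = 1 \/ size B = 1) ->
  bi_irreducible K f.
Proof.
move=> mf sf Kf irr; have [K0 K1 KBM KV] := subK; split=> //.
- exact: monic_neq0.
- by case=> s1; move: sf; rewrite s1.
move=> g h Kg Kh e.
have lgh : lead_coef g * lead_coef h = 1 by rewrite -lead_coefM -e (monicP mf).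
have lhg : lead_coef h * lead_coef g = 1 by rewrite mulrC.
have : lead_coef g \is a GRing.unit by apply/unitrP; exists (lead_coef h).
rewrite poly_unitE => /andP [/size_poly1P [a a0 ea] _].
have Ka : K a.
  have := Kg (size g).-1 0%N; rewrite -[g`__]/(lead_coef g) ea coefC eqxx.
  by [].
have P0 b : b != 0 -> b%:P != 0 :> {poly E} by rewrite polyC_eq0.
have sA : size ((a^-1)%:P *: g) = size g by rewrite size_scale // P0 ?invr_eq0.
have sB : size (a%:P *: h) = size h by rewrite size_scale // P0.
have overZ b (p : {poly {poly E}}) : K b -> bi_over K p -> bi_over K (b%:P *: p).
  move=> Kb Kp i j; rewrite coefZ coefCM; by case: (KBM _ _ Kb (Kp i j)).
have [|||||s1|s1] := irr ((a^-1)%:P *: g) (a%:P *: h).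
- by rewrite monicE lead_coefZ ea -polyCM mulVf.
- by rewrite monicE lead_coefZ -ea lgh.
- by apply: overZ => //; apply: KV.
- exact: overZ.
- by rewrite -scalerAl -scalerAr scalerA -polyCM mulVf // scale1r.
- by left; apply: bi_unit_lead lgh _; rewrite -sA.
by right; apply: bi_unit_lead lhg _; rewrite -sB.
Qed.

Hypothesis hilbK : hilbertian K.

Lemma hilbertian_avoid (f : {poly {poly E}}) (bad : seq E) :
  bi_irreducible K f -> f \is monic -> separable_poly f ->
  exists a, [/\ K a, a \notin bad & uni_irreducible K (specialize f a)].
Proof.
move=> irr mf /separable_in_YP sf; apply: contrapT => h.
apply: (hilbK irr mf sf); exists bad => a Ka ia.
by apply: contraT => nb; case: h; exists a.
Qed.

Lemma hilbertian_infinite : infinite_pred K.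
Proof.
have [K0 K1 KBM KV] := subK => bad.
(* The Hilbertian property is applied to the polynomial Y, which is the outer variable here. *)
have [|||a [Ka nb _]] := @hilbertian_avoid 'X bad; last by exists a.
- apply: bi_irreducible_monic; rewrite ?monicX ?size_polyX //.
    by move=> i j; rewrite coefX; case: eqP; rewrite ?coef0 ?coef1 //; case: (j == 0).
  move=> A B mA mB _ _ /(congr1 (size \o polyseq)) /=.
  rewrite size_polyX size_Mmonic ?monic_neq0 //.
  have := monic_neq0 mA; have := monic_neq0 mB; rewrite -!size_poly_gt0.
  by move: (size A) (size B) => a b; lia.
- exact: monicX.
by rewrite separable_poly.unlock derivX coprimep1.
Qed.

End HilbertianBase.

Section HilbertTheta.

Variables (E : fieldType) (K : E -> Prop).
Hypothesis baseK : galois_base K.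
Hypothesis hilbK : hilbertian K.

Definition transitive_roots th (p : {poly E}) := forall v w, root p v -> root p w ->
  exists s : {rmorphism E -> E}, [/\ Kaut K s, s th = th & s v = w].

(** The Hilbertian property for K(th), with the point still in K. The result is phrased as
    transitivity over the stabilizer of th, a form in which successive choices can be composed. *)
Lemma hilbert_theta th (F : {poly {poly E}}) (bad : seq E) :
  stable_irreducible K th F -> separable_poly F ->
  exists u, [/\ K u, u \notin bad, separable_poly (specialize F u) &
                transitive_roots th (specialize F u)].
Proof.
move=> irrF sepF; have [mF sF fF _] := irrF.
have [badF hbadF] := separable_specialize_finite sepF.
have [o [uo ho]] := orbit_exists baseK th (fun (s : {rmorphism E -> E}) (h : Kaut K s) => h).
have tho : th \in o by apply/ho; exists idfun => //; apply: Kaut_id.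
have ht y : exists s : {rmorphism E -> E}, [/\ Kaut K s, y \in o -> s th = y &
    y = th -> forall z, s z = z].
  have [->|ne] := eqVneq y th; first by exists idfun; split=> //; apply: Kaut_id.
  have [/ho [s sK e]|ny] := boolP (y \in o).
    by exists s; split=> // e'; rewrite e' eqxx in ne.
  by exists idfun; split=> //; apply: Kaut_id.
have {ht} /choice [tau tauP] := ht.
have tauK y : Kaut K (tau y) by case: (tauP y).
have tau_th y : y \in o -> tau y th = y by case: (tauP y).
have tau_id z : tau th z = z by case: (tauP th) => _ _; apply.
(* At the auxiliary point [s0] all roots are listed; this fixes [c], shows that [g] is separable and
   allows degrees to be compared. *)
have [s0 Ks0 ns0] := base_infinite baseK badF.
have pairs_uniq (rs : seq E) : uniq rs -> uniq [seq (tau y r, y) | y <- o, r <- rs].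
  move=> urs; apply: allpairs_uniq => // -[y r] [y' r'] _ _ /= [e1 e2].
  by move: e1; rewrite e2 => /fmorph_inj ->.
have [rs0 urs0 ers0] := base_split baseK (specialize_monic s0 mF) (hbadF _ ns0).
have [c [Kc _ uc]] := separating_coef baseK [::] (pairs_uniq _ urs0).
(* [g] is the norm to [K] of [F(X, Y - c * th)]; the shift by [c] keeps the
   conjugate factors apart. *)
pose sh y : {poly {poly E}} := 'X - ((c * y)%:P)%:P.
have ssh y : size (sh y) = 2 by rewrite size_XsubC.
pose Fy y := act (tau y) F \Po sh y.
have mcomp (A : {poly {poly E}}) y : A \is monic -> A \Po sh y \is monic.
  move=> mA; rewrite monicE lead_coef_comp ?ssh // (monicP mA) lead_coefXsubC.
  by rewrite expr1n mulr1.
have mFy y : Fy y \is monic by apply: mcomp; apply: act_monic.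
pose g := \prod_(y <- o) Fy y.
have mg : g \is monic by apply: monic_prod => y _; apply: mFy.
have spec_sh a y : specialize (sh y) a = 'X - (c * y)%:P.
  by rewrite specializeE rmorphB /= map_polyX map_polyC /= /horner_eval hornerC.
have specFy a y rs : K a -> specialize F a = \prod_(z <- rs) ('X - z%:P) ->
    specialize (Fy y) a = \prod_(z <- [seq tau y r + c * y | r <- rs]) ('X - z%:P).
  move=> Ka e; rewrite specializeE map_comp_poly -!specializeE spec_sh.
  rewrite -{1}(gal_fix (tauK y) Ka) act_specialize e rmorph_prod /=.
  under eq_bigr => z _ do rewrite rmorphB /= map_polyX map_polyC /=.
  by rewrite -(big_map (tau y) xpredT (fun z => 'X - z%:P)) comp_XsubC_prod !big_map.
pose L rs := [seq u.1 + c * u.2 | u <- [seq (tau y r, y) | y <- o, r <- rs]].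
have LE rs : L rs = [seq tau y r + c * y | y <- o, r <- rs].
  by rewrite /L map_allpairs.
have specg a rs : K a -> specialize F a = \prod_(z <- rs) ('X - z%:P) ->
    specialize g a = \prod_(z <- L rs) ('X - z%:P).
  move=> Ka e; rewrite LE specializeE rmorph_prod /= big_allpairs_dep.
  by apply: eq_bigr => y _; rewrite -specializeE (specFy _ _ _ Ka e) big_map.
have sepg : separable_poly g.
  apply: (separable_specialize mg (a := s0)).
  by rewrite (specg _ _ Ks0 ers0) separable_prod_XsubC.
have actFy (s : {rmorphism E -> E}) y : Kaut K s -> y \in o -> act s (Fy y) = Fy (s y) /\ s y \in o.
  move=> sK yo; have [u [uK eu]] := gal_comp sK (tauK y).
  have syo : s y \in o by apply/ho; exists u; rewrite ?eu ?tau_th.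
  split=> //; rewrite /act map_comp_poly /Fy; congr (_ \Po _); last first.
    transitivity (act u F); first by rewrite (@act_comp _ s (tau y) u).
    by apply: (act_stable fF); rewrite ?eu ?tau_th.
  rewrite rmorphB /= map_polyX map_polyC /= map_polyC /= rmorphM /=.
  by rewrite (gal_fix sK Kc).
have actg (s : {rmorphism E -> E}) : Kaut K s -> act s g = g.
  move=> sK; rewrite /act rmorph_prod /=.
  rewrite (eq_big_seq (fun y => Fy (s y))) => [|y yo]; last by have [] := actFy s y sK yo.
  rewrite -(big_map s xpredT Fy); apply: perm_big.
  have uso : uniq (map s o) by rewrite map_inj_uniq //; apply: fmorph_inj.
  have sub : {subset map s o <= o}.
    by move=> _ /mapP [y yo ->]; have [] := actFy s y sK yo.
  by apply: uniq_perm => //; have [] := uniq_min_size uso sub; rewrite ?size_map.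
have over_act (A : {poly {poly E}}) (s : {rmorphism E -> E}) : bi_over K A -> Kaut K s -> act s A = A.
  move=> KA sK; apply/polyP => i; rewrite coef_map /=; apply/polyP => j.
  by rewrite coef_map /= (gal_fix sK (KA i j)).
have Kg : bi_over K g.
  move=> i j; apply: (base_fixed baseK) => s /actg /polyP/(_ i) /polyP/(_ j).
  by rewrite !coef_map.
have FyF : Fy th = F \Po sh th by rewrite /Fy (act_id _ tau_id).
have sg : (1 < size g)%N.
  have Fg : Fy th %| g by rewrite /g (big_rem th) //= dvdp_mulr.
  apply: leq_trans (dvdp_leq (monic_neq0 mg) Fg).
  by rewrite FyF size_comp_poly2.
have sizeL rs : specialize F s0 = \prod_(z <- rs) ('X - z%:P) -> size g = (size (L rs)).+1.
  move=> e; rewrite -(size_specialize s0 mg) (specg _ _ Ks0 e).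
  by rewrite size_prod_XsubC.
(* A factor over K divisible by one conjugate factor is divisible by all of them; at [s0] it then
   has all the roots of [g], so the cofactor is constant. *)
have half (A B : {poly {poly E}}) : A \is monic -> B \is monic -> bi_over K A ->
    g = A * B -> F %| A \Po ('X + ((c * th)%:P)%:P) -> size B = 1.
  move=> mA mB KA eg /(Pdiv.IdomainMonic.dvdpP mF) [q eq].
  have FyA : Fy th %| A.
    rewrite FyF -[A](comp_polyXr) (_ : 'X = ('X + ((c * th)%:P)%:P) \Po sh th); last first.
      by rewrite comp_polyD comp_polyX comp_polyC subrK.
    by rewrite comp_polyA eq comp_polyM dvdp_mull.
  have FyAy y : y \in o -> Fy y %| A.
    move=> yo; have [e _] := actFy (tau y) th (tauK y) tho.
    rewrite -(tau_th y yo) -e -(over_act A (tau y)) //.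
    exact: act_dvdp (mFy th) FyA.
  have rA : all (root (specialize A s0)) (L rs0).
    apply/allP => z; rewrite LE => /allpairsP [[y r] /= [yo rrs ->]].
    have := specialize_dvdp s0 (mFy y) (FyAy y yo); rewrite (specFy _ _ _ Ks0 ers0).
    move=> h; rewrite -dvdp_XsubCl; apply: dvdp_trans h; rewrite dvdp_XsubCl.
    by rewrite root_prod_XsubC; apply/mapP; exists r.
  have A0 : specialize A s0 != 0 by apply/monic_neq0/specialize_monic.
  have := max_poly_roots A0 rA uc; rewrite (size_specialize _ mA) -/(L rs0).
  have := sizeL _ ers0; rewrite {1}eg size_Mmonic ?monic_neq0 //.
  have := monic_neq0 mB; rewrite -size_poly_gt0.
  move: (size A) (size B) (size (L rs0)); clear => a b l; lia.
have irrg : bi_irreducible K g.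
  apply: (bi_irreducible_monic (base_subfield baseK) mg sg Kg) => A B mA mB KA KB eg.
  pose up : {poly {poly E}} := 'X + ((c * th)%:P)%:P.
  have FAB : F %| (A \Po up) * (B \Po up).
    rewrite -comp_polyM -eg.
    have -> : F = Fy th \Po up.
      rewrite FyF -comp_polyA (_ : sh th \Po up = 'X) ?comp_polyXr //.
      by rewrite comp_polyB comp_polyX comp_polyC addrK.
    by rewrite /g (big_rem th) //= comp_polyM dvdp_mulr.
  have stA C : bi_over K C -> stable K th (C \Po up).
    move=> KC s sK sth; rewrite /act map_comp_poly /= -/(act s C) over_act //.
    congr (_ \Po _); rewrite rmorphD /= map_polyX map_polyC /= map_polyC /=.
    by rewrite rmorphM /= sth (gal_fix sK Kc).
  have [h|h] := stable_prime irrF (stA A KA) FAB; [right|left]; first exact: half h.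
  by apply: half h => //; rewrite mulrC.
have [badg hbadg] := separable_specialize_finite sepg.
have [u [Ku]] := hilbertian_avoid hilbK (bad ++ badg ++ badF) irrg mg sepg.
rewrite !mem_cat !negb_or => /and3P [nb nbg nbF] irru.
exists u; split=> //; first exact: hbadF.
have [rs urs ers] := base_split baseK (specialize_monic u mF) (hbadF _ nbF).
move=> v w; rewrite ers !root_prod_XsubC => vrs wrs.
have sepgu := hbadg _ nbg; have egu := specg _ _ Ku ers.
have uL : uniq (L rs) by rewrite -separable_prod_XsubC -egu.
have mem y r : y \in o -> r \in rs -> (tau y r, y) \in [seq (tau y r, y) | y <- o, r <- rs].
  by move=> yo rr; apply/allpairsP; exists (y, r).
have rt y r : y \in o -> r \in rs -> root (specialize g u) (tau y r + c * y).
  by move=> yo rr; rewrite egu root_prod_XsubC; apply/mapP; exists (tau y r, y) => //; apply: mem.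
have [s sK] := irreducible_transitive baseK irru (specialize_monic _ mg) sepgu
   (rt _ _ tho vrs) (rt _ _ tho wrs).
rewrite !tau_id rmorphD rmorphM /= (gal_fix sK Kc) => e.
have sto : s th \in o by apply/ho; exists s.
have [r rrs er] : exists2 r, r \in rs & s v = tau (s th) r.
  have : root (map_poly (tau (s th)) (specialize F u)) (s v).
    rewrite -act_specialize (gal_fix (tauK _) Ku) -(act_stable fF sK (tauK _)) ?tau_th //.
    rewrite -{1}(gal_fix sK Ku) act_specialize; apply/rootP; rewrite horner_map.
    by rewrite ers (rootP _) ?rmorph0 // root_prod_XsubC.
  rewrite ers rmorph_prod /=.
  under eq_bigr => z _ do rewrite rmorphB /= map_polyX map_polyC /=.
  rewrite -(big_map (tau (s th)) xpredT (fun z => 'X - z%:P)) root_prod_XsubC.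
  by move/mapP => [r rr ->]; exists r.
(* The sums determine their pairs, so an automorphism carrying v + c th to w + c th fixes th and
   sends v to w. *)
have inj := map_uniq_inj uL (mem _ _ sto rrs) (mem _ _ tho wrs).
move: inj; rewrite /= -er tau_id => /(_ e) [e1 e2].
by exists s.
Qed.

End HilbertTheta.

(** * Jointly transitive specializations *)

Lemma finite_exceptions (E T : eqType) (P : T -> E -> Prop) (ts : seq T) :
  (forall t, t \in ts -> exists s : seq E, forall a, a \notin s -> P t a) ->
  exists s : seq E, forall a, a \notin s -> forall t, t \in ts -> P t a.
Proof.
elim: ts => [|t ts IH] h; first by exists [::].
have [s1 h1] := h t (mem_head _ _).
have [|s2 h2] := IH; first by move=> u uts; apply: h; rewrite inE uts orbT.
exists (s1 ++ s2) => a; rewrite mem_cat negb_or => /andP [n1 n2] u.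
by rewrite inE => /orP [/eqP ->|]; [apply: h1|apply: h2].
Qed.

Section MultiSum.

Fixpoint dot (R : pzRingType) (cs vs : seq R) : R :=
  if (cs, vs) is (c :: cs', v :: vs') then c * v + dot cs' vs' else 0.

Fixpoint sums (R : pzRingType) (cs : seq R) (zss : seq (seq R)) : seq R :=
  if (cs, zss) is (c :: cs', zs :: zss')
  then [seq c * z + t | z <- zs, t <- sums cs' zss'] else [:: 0].

(** Its roots are the numbers [dot cs vs] with one root chosen from each polynomial, so that a tuple
    of roots becomes a single root. The index is [(size A).-2] because [companion n] has n + 1 rows
    and [size A] is the degree plus one. *)
Fixpoint multi_sum (R : comNzRingType) (cs : seq R) (As : seq {poly R}) : {poly R} :=
  if (cs, As) is (c :: cs', A :: As') then sum_poly (size A).-2 c A (multi_sum cs' As')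
  else 'X.

Lemma dot_map (R : pzRingType) (s : {rmorphism R -> R}) (cs vs : seq R) :
  {in cs, forall c, s c = c} -> s (dot cs vs) = dot cs (map s vs).
Proof.
elim: cs vs => [|c cs IH] [|v vs] h; rewrite /= ?rmorph0 //.
rewrite rmorphD rmorphM h ?mem_head // IH // => d dcs.
by apply: h; rewrite inE dcs orbT.
Qed.

Definition tuple_of (T : eqType) (zss : seq (seq T)) (vs : seq T) :=
  all2 (fun zs v => v \in zs) zss vs.

Lemma mem_sumsP (R : nzRingType) (cs : seq R) zss t : size cs = size zss ->
  reflect (exists2 vs, tuple_of zss vs & t = dot cs vs) (t \in sums cs zss).
Proof.
elim: cs zss t => [|c cs IH] [|zs zss] //= t.
  move=> _; rewrite inE; apply: (iffP eqP) => [->|[vs _ ->]]; last by case: vs.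
  by exists [::].
case=> sz; apply: (iffP allpairsP) => [[[z u] /= [zzs /(IH _ _ sz) [vs hvs ->] ->]]|].
  by exists (z :: vs) => //=; rewrite zzs.
case=> -[|v vs] //= /andP [vzs hvs] ->; exists (v, dot cs vs); split=> //=.
by apply/(IH _ _ sz); exists vs.
Qed.

Lemma sums_inj (R : nzRingType) (cs : seq R) zss vs ws : size cs = size zss ->
  uniq (sums cs zss) -> tuple_of zss vs -> tuple_of zss ws ->
  dot cs vs = dot cs ws -> vs = ws.
Proof.
elim: cs zss vs ws => [|c cs IH] [|zs zss] [|v vs] [|w ws] //= [sz] u.
move=> /andP [vzs hvs] /andP [wzs hws] e.
have dvs : dot cs vs \in sums cs zss by apply/(mem_sumsP _ sz); exists vs.
have dws : dot cs ws \in sums cs zss by apply/(mem_sumsP _ sz); exists ws.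
pose h u : R := c * u.1 + u.2.
have u' : uniq (map h [seq (z, t) | z <- zs, t <- sums cs zss]) by rewrite map_allpairs.
have mem y t : y \in zs -> t \in sums cs zss -> (y, t) \in [seq (z, t) | z <- zs, t <- sums cs zss].
  by move=> yz ts; apply/allpairsP; exists (y, t).
have := map_uniq_inj u' (mem _ _ vzs dvs) (mem _ _ wzs dws); rewrite /h /= => /(_ e) [-> e2].
rewrite (IH zss vs ws) //.
have us : uniq [seq c * v + t | t <- sums cs zss].
  rewrite map_inj_in_uniq; last by move=> ? ? _ _ /addrI.
  case: zs vzs u {wzs u' mem} => // z zs _; rewrite /= cat_uniq => /andP [].
  by move/map_uniq.
exact: map_uniq us.
Qed.

Lemma size_sums (R : pzRingType) (cs : seq R) zss n : size cs = size zss ->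
  (forall zs, zs \in zss -> size zs = n) -> size (sums cs zss) = (n ^ size zss)%N.
Proof.
elim: cs zss => [|c cs IH] [|zs zss] //= [sz] h; rewrite size_allpairs IH //.
  by rewrite h ?mem_head // expnS.
by move=> zs' h'; apply: h; rewrite inE h' orbT.
Qed.

Lemma map_multi_sum (R R' : comNzRingType) (f : {rmorphism R -> R'}) cs As :
  (forall A, A \in As -> A \is monic) ->
  map_poly f (multi_sum cs As) = multi_sum (map f cs) (map (map_poly f) As).
Proof.
elim: cs As => [|c cs IH] [|A As] h /=; rewrite ?map_polyX //.
rewrite map_sum_poly IH => [|B BAs]; last by apply: h; rewrite inE BAs orbT.
by rewrite size_map_poly_id0 // (monicP (h A (mem_head _ _))) rmorph1 oner_neq0.
Qed.

Lemma multi_sum_split (R : idomainType) (cs : seq R) zss : size cs = size zss ->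
  (forall zs, zs \in zss -> uniq zs /\ (0 < size zs)%N) ->
  multi_sum cs [seq \prod_(z <- zs) ('X - z%:P) | zs <- zss]
    = \prod_(t <- sums cs zss) ('X - t%:P).
Proof.
elim: cs zss => [|c cs IH] [|zs zss] //=; first by rewrite big_seq1 subr0.
case=> sz h; have [uz sz0] := h zs (mem_head _ _).
have h' zs' : zs' \in zss -> uniq zs' /\ (0 < size zs')%N.
  by move=> h'; apply: h; rewrite inE h' orbT.
rewrite sum_poly_split // ?size_prod_XsubC /= ?prednK //.
rewrite IH // big_allpairs_dep; apply: eq_bigr => z _ /=.
by rewrite comp_XsubC_prod; apply: eq_bigr => t _; rewrite [t + _]addrC.
Qed.

End MultiSum.

Section JointPoints.

Variables (E : fieldType) (K : E -> Prop).
Hypothesis baseK : galois_base K.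
Hypothesis hilbK : hilbertian K.
Implicit Types (s t : {rmorphism E -> E}) (th : E).

Lemma separating_sums (zss : seq (seq E)) : (forall zs, zs \in zss -> uniq zs) ->
  exists cs, [/\ size cs = size zss, (forall c, c \in cs -> K c) & uniq (sums cs zss)].
Proof.
elim: zss => [|zs zss IH] h; first by exists [::].
have [|cs [sz Kcs ucs]] := IH; first by move=> zs' h'; apply: h; rewrite inE h' orbT.
have ups : uniq [seq (u, z) | z <- zs, u <- sums cs zss].
  apply: allpairs_uniq => //; first by rewrite h ?mem_head.
  by move=> [? ?] [? ?] _ _ /= [-> ->].
have [c [Kc _ uc]] := separating_coef baseK [::] ups.
exists (c :: cs); split=> [||]; first by rewrite /= sz.
  by move=> d; rewrite inE => /orP [/eqP ->|/Kcs].
move: uc; rewrite map_allpairs /=; congr (is_true (uniq (flatten _))).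
by apply: eq_map => z; apply: eq_map => u; rewrite addrC.
Qed.

Definition jointly_transitive th (ps : seq {poly E}) := forall vs ws,
  all2 root ps vs -> all2 root ps ws ->
  exists s, [/\ Kaut K s, s th = th & map s vs = ws].

Definition absolutely_irreducible (F : {poly {poly E}}) :=
  [/\ F \is monic, (1 < size F)%N, separable_poly F &
    forall A B : {poly {poly E}}, A \is monic -> B \is monic -> F = A * B ->
      size A = 1 \/ size B = 1].

Lemma absolutely_irreducible_stable th F : absolutely_irreducible F -> stable K th F ->
  stable_irreducible K th F.
Proof. by case=> mF sF sepF irr fF; split=> // A B mA mB _ _; apply: irr. Qed.

Lemma specialize_fixed th F s u : stable K th F -> Kaut K s -> s th = th -> s u = u ->
  map_poly s (specialize F u) = specialize F u.
Proof. by move=> fF sK sth su; rewrite -act_specialize su fF. Qed.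

Lemma root_map_fixed s (p : {poly E}) v : map_poly s p = p -> root p v -> root p (s v).
Proof. by move=> e /rootP pv; apply/rootP; rewrite -e horner_map pv rmorph0. Qed.

Lemma all2_root_map s (ps : seq {poly E}) vs :
  (forall p, p \in ps -> map_poly s p = p) -> all2 root ps vs -> all2 root ps (map s vs).
Proof.
elim: ps vs => [|p ps IH] [|v vs] //= h /andP [pv pvs].
rewrite (root_map_fixed (h p (mem_head _ _)) pv) IH // => q qps.
by apply: h; rewrite inE qps orbT.
Qed.

(** The later points are chosen over the field that contains all roots [rs] at the first one. A
    first automorphism adjusts the root at [u]; a second one, fixing [rs], then adjusts the others
    without disturbing it. *)
Lemma joint_points th F (bad : seq E) r : absolutely_irreducible F -> stable K th F ->
  exists us, [/\ size us = r, (forall u, u \in us -> [/\ K u, u \notin bad &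
      separable_poly (specialize F u)]) & jointly_transitive th (map (specialize F) us)].
Proof.
move=> irrF; elim: r th => [|r IH] th fF.
  exists [::]; split=> // -[|v vs] [|w ws] // _ _.
  by exists idfun; split=> //; apply: Kaut_id.
have [mF _ sepF _] := irrF.
have [u [Ku nb sepu tru]] := hilbert_theta baseK hilbK bad (absolutely_irreducible_stable irrF fF) sepF.
have [rs urs ers] := base_split baseK (specialize_monic u mF) sepu.
have [th' hth'] := primitive_list baseK (th :: rs).
have th'th s : Kaut K s -> s th' = th' -> s th = th.
  by move=> sK /(hth' _ sK) h; apply: h; rewrite mem_head.
have fF' : stable K th' F by move=> s sK /(th'th _ sK); apply: fF.
have [us [sus hus jus]] := IH th' fF'.
exists (u :: us); split=> [||vs ws]; first by rewrite /= sus.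
  by move=> u'; rewrite inE => /orP [/eqP -> //|]; apply: hus.
case: vs ws => [|v vs] [|w ws] //= /andP [rv rvs] /andP [rw rws].
have [s1 [s1K s1th s1v]] := tru v w rv rw.
have rs1 : all2 root (map (specialize F) us) (map s1 vs).
  apply: all2_root_map rvs => _ /mapP [u' u'us ->].
  by have [Ku' _ _] := hus _ u'us; rewrite (specialize_fixed fF) // (gal_fix s1K).
have [s2 [s2K s2th s2v]] := jus _ _ rs1 rws.
have [s [sK es]] := gal_comp s2K s1K.
have fix2 : fixes s2 (th :: rs) by apply/hth'.
exists s; split=> //; first by rewrite es s1th fix2 ?mem_head.
rewrite es s1v fix2; last by rewrite inE -root_prod_XsubC -ers rw orbT.
by rewrite -s2v -map_comp; congr cons; apply: eq_map => x /=; rewrite es.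
Qed.

Lemma tuple_of_roots (ps : seq {poly E}) zss vs :
  ps = [seq \prod_(z <- zs) ('X - z%:P) | zs <- zss] -> all2 root ps vs = tuple_of zss vs.
Proof.
move=> ->; elim: zss vs => [|zs zss IH] [|v vs] //=.
by rewrite IH root_prod_XsubC.
Qed.

Lemma split_all (ps : seq {poly E}) n :
  (forall p, p \in ps -> [/\ p \is monic, separable_poly p & size p = n.+1]) ->
  exists2 zss, ps = [seq \prod_(z <- zs) ('X - z%:P) | zs <- zss] &
    forall zs, zs \in zss -> uniq zs /\ size zs = n.
Proof.
elim: ps => [|p ps IH] h; first by exists [::].
have [|zss e hz] := IH; first by move=> q qps; apply: h; rewrite inE qps orbT.
have [mp sp szp] := h p (mem_head _ _).
have [zs uz ez] := base_split baseK mp sp.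
exists (zs :: zss) => [|zs']; first by rewrite /= -ez -e.
rewrite inE => /orP [/eqP ->|/hz //]; split=> //.
by apply: succn_inj; rewrite -szp ez size_prod_XsubC.
Qed.

(** The degree of a determinant such as [multi_sum] is awkward to read off; here it is recovered
    from the values, since a coefficient vanishing at infinitely many points is 0. *)
Lemma monic_of_specialize (Q : {poly {poly E}}) (bad : seq E) n :
  (forall a, a \notin bad -> specialize Q a \is monic /\ size (specialize Q a) = n.+1) ->
  Q \is monic /\ size Q = n.+1.
Proof.
move=> h.
have zero (p : {poly E}) : (forall a, a \notin bad -> p.[a] = 0) -> p = 0.
  move=> hp; apply/eqP; apply: contraT => /roots_finite [s hs].
  have [a _] := base_infinite baseK (bad ++ s); rewrite mem_cat negb_or.
  by case/andP => nb /negP []; apply: hs; apply/rootP/hp.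
have cn : Q`_n = 1.
  apply/eqP; rewrite -subr_eq0; apply/eqP; apply: zero => a na.
  have [/monicP mQ sQ] := h a na; rewrite hornerD hornerN hornerC.
  by rewrite -coef_specialize -mQ /lead_coef sQ subrr.
have sQ : size Q = n.+1.
  apply/eqP; rewrite eqn_leq; apply/andP; split; last first.
    by apply: contraT; rewrite -ltnNge ltnS => /leq_sizeP/(_ n (leqnn _)); rewrite cn => /eqP; rewrite oner_eq0.
  apply/leq_sizeP => j nj; apply: zero => a na; rewrite -coef_specialize.
  by rewrite nth_default //; have [_ ->] := h a na.
by split=> //; rewrite monicE /lead_coef sQ cn.
Qed.

Lemma divisor_root (p q : {poly E}) : separable_poly q -> p %| q ->
  size p <> 1 -> exists v, root p v.
Proof.
move=> sq pq sp.
have p0 : p != 0.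
  apply: contraTneq sq => p0; move: pq; rewrite p0 dvd0p => /eqP ->.
  by rewrite separable_poly.unlock deriv0 coprimep0 -size_poly_eq1 size_poly0.
have lp : (lead_coef p)^-1 != 0 by rewrite invr_eq0 lead_coef_eq0.
have mp : (lead_coef p)^-1 *: p \is monic.
  by rewrite monicE lead_coefZ mulVf // lead_coef_eq0.
have [|[|z zs] uz e] := base_split baseK mp.
- by apply: dvdp_separable sq; rewrite dvdpZl.
- by case: sp; rewrite -(size_scale _ lp) e big_nil size_poly1.
by exists z; rewrite -(rootZ _ _ lp) e root_prod_XsubC mem_head.
Qed.

(** A stable factorization would divide the roots at X = th into two disjoint nonempty sets, each
    preserved by the stabilizer of th. *)
Lemma transitive_specialize_irreducible th (Q : {poly {poly E}}) :
  Q \is monic -> (1 < size Q)%N -> stable K th Q -> separable_poly (specialize Q th) ->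
  transitive_roots K th (specialize Q th) -> stable_irreducible K th Q.
Proof.
move=> mQ sQ fQ sepQ trQ; split=> // A B mA mB fA fB e.
apply: contrapT => /not_orP [sA sB].
have eth : specialize Q th = specialize A th * specialize B th by rewrite e specializeM.
have [||v rv] := @divisor_root (specialize A th) _ sepQ.
- by rewrite eth dvdp_mulr.
- by rewrite size_specialize.
have [||w rw] := @divisor_root (specialize B th) _ sepQ.
- by rewrite eth dvdp_mull.
- by rewrite size_specialize.
have [||s [sK sth sv]] := trQ v w; rewrite ?eth ?rootM ?rv ?rw ?orbT //.
have := root_map_fixed (specialize_fixed fA sK sth sth) rv; rewrite sv => rAw.
have cop : coprimep (specialize A th) (specialize B th).
  by apply: separable_coprime sepQ _; rewrite eth.
by have := coprimep_root cop rAw; rewrite (rootP rw) eqxx.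
Qed.

Lemma conjugate_points th F (zs bad : seq E) :
  absolutely_irreducible F -> stable K th F -> uniq zs ->
  (forall s z, Kaut K s -> s th = th -> z \in zs -> s z = z) ->
  exists b : {poly E}, [/\ poly_over K b,
     (forall z, z \in zs -> b.[z] \notin bad /\ separable_poly (specialize F b.[z])) &
     jointly_transitive th [seq specialize F b.[z] | z <- zs]].
Proof.
move=> irrF fF uzs fzs; have [mF sF sepF _] := irrF.
have [us [sus hus jus]] := joint_points bad (size zs) irrF fF.
have [B0 [sB0 hB0]] := interpolation (fun z => us`_(index z zs)) uzs.
have us_zs : us = [seq B0.[z] | z <- zs].
  apply: (@eq_from_nth _ 0); rewrite ?size_map // => i; rewrite sus => ltr.
  by rewrite (nth_map 0) // hB0 ?mem_nth // index_uniq.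
(* The nodes [zs] lie in K(th) and the values in K, so the coefficients of [B0] lie in K(th) and are
   polynomials [q j] in th. *)
have fB0 s : Kaut K s -> s th = th -> map_poly s B0 = B0.
  move=> sK sth; apply: (@interpolation_unique _ zs); rewrite ?size_map_poly //.
  move=> z zzs; rewrite -{1}(fzs s z sK sth zzs) horner_map /=.
  have : B0.[z] \in us by rewrite us_zs map_f.
  by case/hus => Ku _ _; rewrite (gal_fix sK Ku).
have hq j : exists q, poly_over K q /\ q.[th] = B0`_j.
  have [|q Kq qth] := @poly_in_primitive _ _ baseK th B0`_j; last by exists q.
  by move=> s sK sth; have /polyP/(_ j) := fB0 s sK sth; rewrite coef_map.
have {hq} /choice [q hq] := hq.
pose r := size B0.
(* [P z] and [b a] are the two readings of one polynomial in a and z: the curve [P z] passes through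
   B0(z) at a = th, and for a in K its points are values of a polynomial over K. *)
pose P z : {poly E} := \sum_(j < r) z ^+ j *: q j.
pose b a : {poly E} := \poly_(j < r) (q j).[a].
have Pb z a : (P z).[a] = (b a).[z].
  rewrite /P horner_sum horner_poly; apply: eq_bigr => j _.
  by rewrite hornerZ mulrC.
have Pth z : (P z).[th] = B0.[z].
  rewrite Pb horner_poly horner_coef; apply: eq_bigr => j _.
  by have [_ ->] := hq j.
have [K0 _ _ _] := base_subfield baseK.
have Kb a : K a -> poly_over K (b a).
  move=> Ka j; rewrite coef_poly; case: ifP => // _.
  apply: (base_fixed baseK) => s sK.
  rewrite -horner_map (gal_fix sK Ka); congr _.[_].
  by apply/polyP => i; rewrite coef_map /= (gal_fix sK) //; case: (hq j).
have fP s z : Kaut K s -> s z = z -> map_poly s (P z) = P z.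
  move=> sK sz; rewrite rmorph_sum /=; apply: eq_bigr => j _.
  rewrite map_polyZ /= rmorphXn /= sz; congr (_ *: _).
  by apply/polyP => i; rewrite coef_map /= (gal_fix sK) //; case: (hq j).
pose G z : {poly {poly E}} := map_poly (comp_poly (P z)) F.
have mG z : G z \is monic by apply: monic_map.
have specG z a : specialize (G z) a = specialize F (P z).[a].
  apply/polyP => i; rewrite !coef_specialize coef_map /=.
  by rewrite horner_comp.
(* At th both requirements hold by the choice of [us], so neither fails identically along the
   curve. *)
have exc_ok z : z \in zs -> exists s : seq E, forall a, a \notin s ->
    (P z).[a] \notin bad /\ separable_poly (specialize F (P z).[a]).
  move=> zzs; have : B0.[z] \in us by rewrite us_zs map_f.
  case/hus => _ nb sepu.
  have [|s1 h1] := @separable_specialize_finite _ (G z).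
    by apply: (separable_specialize (mG z) (a := th)); rewrite specG Pth.
  have [|s2 h2] := @finite_exceptions _ _ (fun d a => (P z).[a] != d) bad.
    move=> d dbad; have [|s hs] := @roots_finite _ (P z - d%:P).
      apply: contraNneq nb => /(congr1 (fun p => p.[th])).
      rewrite hornerD hornerN hornerC Pth horner0 => /eqP.
      by rewrite subr_eq0 => /eqP ->.
    exists s => a; apply: contra => /eqP e; apply: hs; apply/rootP.
    by rewrite hornerD hornerN hornerC e subrr.
  exists (s1 ++ s2) => a; rewrite mem_cat negb_or => /andP [n1 n2].
  rewrite -specG; split; last exact: h1.
  by apply/negP => /(h2 a n2); rewrite eqxx.
have [exc hexc] := finite_exceptions exc_ok.
pose n := (size F).-1; have n0 : (0 < n)%N by rewrite /n -ltnS prednK // ltnW.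
have sn a : size (specialize F a) = n.+1 by rewrite size_specialize // /n prednK // ltnW.
have split_at a : a \notin exc -> exists2 zss,
    [seq specialize F (P z).[a] | z <- zs] = [seq \prod_(z <- zs) ('X - z%:P) | zs <- zss] &
    forall zs, zs \in zss -> uniq zs /\ size zs = n.
  move=> na; apply: split_all => _ /mapP [z zzs ->]; split=> //.
    exact: specialize_monic.
  by have [] := hexc a na z zzs.
have [|zss0 ezss0 hzss0] := @split_all [seq specialize F B0.[z] | z <- zs] n.
  move=> _ /mapP [z zzs ->]; split=> //; first exact: specialize_monic.
  have : B0.[z] \in us by rewrite us_zs map_f.
  by case/hus.
have [|cs [scs Kcs ucs]] := @separating_sums zss0; first by move=> zs' /hzss0 [].
pose Q := multi_sum (map polyC cs) (map G zs).
have szss zss ps :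
    ps = [seq \prod_(z <- zs) ('X - z%:P) : {poly E} | zs <- zss] ->
    size ps = size zs -> size cs = size zss.
  move=> e se; rewrite scs; have := congr1 size ezss0; rewrite !size_map => <-.
  by move: se; rewrite e size_map.
have specQ a zss : [seq specialize F (P z).[a] | z <- zs] = [seq \prod_(z <- zs) ('X - z%:P) | zs <- zss] ->
    (forall zs, zs \in zss -> uniq zs /\ size zs = n) ->
    specialize Q a = \prod_(t <- sums cs zss) ('X - t%:P).
  move=> e hz; rewrite specializeE map_multi_sum => [|_ /mapP [z _ ->] //].
  rewrite -map_comp (eq_map (g := id)) ?map_id => [|c]; last by rewrite /= /horner_eval hornerC.
  rewrite -map_comp (eq_map (g := fun z => specialize F (P z).[a])) => [|z]; last exact: specG.
  rewrite e multi_sum_split //; first by apply: szss e _; rewrite size_map.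
  by move=> zs' /hz [? ->].
have Qth : specialize Q th = \prod_(t <- sums cs zss0) ('X - t%:P).
  apply: specQ => //; rewrite -ezss0; apply: eq_map => z; by rewrite Pth.
have [|mQ sQ] := @monic_of_specialize Q exc (n ^ size zs).
  move=> a /split_at [zss e hz]; rewrite (specQ a zss) //.
  rewrite monic_prod_XsubC size_prod_XsubC (@size_sums _ _ _ n).
  - by split=> //; have := congr1 size e; rewrite !size_map => ->.
  - by apply: szss e _; rewrite size_map.
  - by move=> zs' /hz [].
have sepQth : separable_poly (specialize Q th) by rewrite Qth separable_prod_XsubC.
have fcs s : Kaut K s -> {in cs, forall c, s c = c}.
  by move=> sK c /Kcs Kc; apply: gal_fix Kc.
have fQ : stable K th Q.
  move=> s sK sth; rewrite /act map_multi_sum => [|_ /mapP [z _ ->] //].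
  rewrite -!map_comp; congr multi_sum.
    by apply/eq_in_map => c ccs /=; rewrite map_polyC /= (fcs s sK).
  apply/eq_in_map => z zzs /=; rewrite /G -{2}(fF s sK sth) -!map_poly_comp.
  apply: eq_map_poly => c /=; rewrite map_comp_poly /=.
  by rewrite fP // (fzs s).
have tupP a zss vs : [seq specialize F (P z).[a] | z <- zs] = [seq \prod_(z <- zs) ('X - z%:P) | zs <- zss] ->
    tuple_of zss vs -> dot cs vs \in sums cs zss.
  by move=> e hvs; apply/mem_sumsP; [apply: szss e _; rewrite size_map|exists vs].
(* At th the roots of [Q] encode tuples of roots over the points [us], on which the stabilizer of th
   is transitive. *)
have irrQ : stable_irreducible K th Q.
  apply: transitive_specialize_irreducible => //; first by rewrite sQ ltnS expn_gt0 n0.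
  have scs0 : size cs = size zss0 by [].
  move=> v w; rewrite Qth !root_prod_XsubC.
  move=> /(mem_sumsP _ scs0) [vs hvs ->] /(mem_sumsP _ scs0) [ws hws ->].
  have [||s [sK sth svs]] := jus vs ws.
  - by rewrite us_zs -map_comp (tuple_of_roots _ ezss0).
  - by rewrite us_zs -map_comp (tuple_of_roots _ ezss0).
  by exists s; split=> //; rewrite dot_map ?svs //; apply: fcs.
have [a [Ka na sepa tra]] := hilbert_theta baseK hilbK exc irrQ (separable_specialize mQ sepQth).
have [zss e hz] := split_at a na.
exists (b a); split; first exact: Kb.
  by move=> z zzs; rewrite -Pb; apply: hexc.
have e' : [seq specialize F (b a).[z] | z <- zs] = [seq \prod_(z <- zs) ('X - z%:P) | zs <- zss].
  by rewrite -e; apply: eq_map => z; rewrite Pb.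
have scs' : size cs = size zss by apply: szss e _; rewrite size_map.
move=> vs ws rvs rws.
have tvs : tuple_of zss vs by rewrite -(tuple_of_roots _ e').
have tws : tuple_of zss ws by rewrite -(tuple_of_roots _ e').
have [||s [sK sth sv]] := tra (dot cs vs) (dot cs ws).
- by rewrite (specQ a zss) // root_prod_XsubC (tupP a).
- by rewrite (specQ a zss) // root_prod_XsubC (tupP a).
(* The automorphism matches the two combinations; since [sums cs zss] has no repetition, it matches
   the tuples. *)
exists s; split=> //; apply: (sums_inj scs') => //.
- by rewrite -separable_prod_XsubC -(specQ a zss).
- rewrite -(tuple_of_roots _ e'); apply: all2_root_map rvs => _ /mapP [z zzs ->].
  apply: (specialize_fixed fF) => //; rewrite -horner_map /= (fzs s) //.
  congr _.[_]; apply/polyP => i; rewrite coef_map /= (gal_fix sK) //; exact: Kb.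
by rewrite -(dot_map vs (fcs s sK)).
Qed.

End JointPoints.

(** * The absolute Galois group of [L[sg]_K] *)

Section Blocks.

Variables (E : fieldType) (K : E -> Prop).
Hypothesis baseK : galois_base K.

Lemma absolutely_irreducible_factor (f : {poly {poly E}}) :
  f \is monic -> (1 < size f)%N -> separable_poly f ->
  exists2 f1, absolutely_irreducible f1 & f1 %| f.
Proof.
move=> mf sf sepf.
have ex : exists n, `[< exists d : {poly {poly E}},
    [/\ d \is monic, (1 < size d)%N, d %| f & size d = n] >].
  by exists (size f); apply/asboolP; exists f.
case: (ex_minnP ex) => n /asboolP [d [md sd df <-]] min_d {n}.
exists d => //; split=> //; first exact: dvdp_separable sepf.
move=> A B mA mB e; apply: contrapT => /not_orP [sA sB].
have A0 := monic_neq0 mA; have B0 := monic_neq0 mB.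
have /min_d : `[< exists d' : {poly {poly E}},
    [/\ d' \is monic, (1 < size d')%N, d' %| f & size d' = size A] >].
  apply/asboolP; exists A; split=> //.
    by rewrite ltn_neqAle eq_sym size_poly_gt0 A0 andbT; apply/eqP.
  by apply: dvdp_trans df; rewrite e dvdp_mulr.
rewrite e size_Mmonic //; move: sA sB A0 B0; rewrite -!size_poly_gt0.
by move: (size A) (size B); clear => a b; lia.
Qed.

Lemma absolutely_irreducible_coprime (h1 h2 : {poly {poly E}}) :
  absolutely_irreducible h1 -> absolutely_irreducible h2 -> h1 != h2 -> coprimep h1 h2.
Proof.
move=> [m1 _ _ irr1] [m2 _ _ irr2] ne.
have [d [md d1 d2 dmax]] := monic_gcd h2 m1.
have /(Pdiv.IdomainMonic.dvdpP md) [q1 e1] := d1.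
have /(Pdiv.IdomainMonic.dvdpP md) [q2 e2] := d2.
have mq1 : q1 \is monic by move: m1; rewrite e1 monicMr.
have mq2 : q2 \is monic by move: m2; rewrite e2 monicMr.
have [s1|sd] := irr1 _ _ mq1 md e1; last first.
  apply/coprimepP => d' h h'; rewrite /eqp dvd1p andbT.
  by rewrite -(monic_size1 md sd) dmax.
have [s2|sd] := irr2 _ _ mq2 md e2.
  by case/eqP: ne; rewrite e1 e2 (monic_size1 mq1 s1) (monic_size1 mq2 s2).
apply/coprimepP => d' h h'; rewrite /eqp dvd1p andbT.
by rewrite -(monic_size1 md sd) dmax.
Qed.

Lemma prod_absolutely_irreducible_dvdp (hs : seq {poly {poly E}}) f : uniq hs ->
  (forall h, h \in hs -> absolutely_irreducible h /\ h %| f) -> \prod_(h <- hs) h %| f.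
Proof.
elim: hs => [|h hs IH] /= => [_ _|/andP [nh uhs] irr]; first by rewrite big_nil dvd1p.
have irr' h' : h' \in hs -> absolutely_irreducible h' /\ h' %| f.
  by move=> h'hs; apply: irr; rewrite inE h'hs orbT.
rewrite big_cons Gauss_dvdp; first by rewrite (irr h (mem_head _ _)).2 IH.
rewrite big_seq; apply: (big_ind (coprimep h)) => [|x y|h' h'hs].
- exact: coprimep1.
- by rewrite coprimepMr => -> ->.
apply: absolutely_irreducible_coprime; first by case: (irr h (mem_head _ _)).
  by case: (irr' _ h'hs).
by apply: contraNneq nh => ->.
Qed.

Lemma act_absolutely_irreducible (s : {rmorphism E -> E}) h : Kaut K s ->
  absolutely_irreducible h -> absolutely_irreducible (act s h).
Proof.
move=> sK [mh sh seph irr]; have [t [tK st ts]] := gal_inv sK.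
have [[id1 e1] [id2 e2]] : (exists i : {rmorphism E -> E}, forall x, i x = t (s x)) /\
   (exists i : {rmorphism E -> E}, forall x, i x = s (t x)).
  by split; [exists (t \o s)|exists (s \o t)].
have actK A : act t (act s A) = A.
  by rewrite -(act_comp A e1) act_id // => x; rewrite e1 st.
split; [exact: act_monic|by rewrite size_act| |].
  move: seph; rewrite separable_poly.unlock => /Pdiv.Idomain.Bezout_coprimepP.
  case=> [[u v] /eqpP [[c1 c2] /= /andP [h1 h2] e]].
  apply/Pdiv.Idomain.Bezout_coprimepP; exists (act s u, act s v) => /=.
  apply/eqpP; exists (map_poly s c1, map_poly s c2) => /=.
    by rewrite !map_poly_eq0 h1.
  rewrite /act deriv_map.
  move/(congr1 (act s)): e; rewrite /act !map_polyZ rmorphD !rmorphM rmorph1.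
  by [].
move=> A B mA mB e.
rewrite -(size_act t A) -(size_act t B); apply: irr; try exact: act_monic.
by rewrite -actM -e actK.
Qed.

End Blocks.

Section FixedPart.

Variables (E : fieldType) (K L : E -> Prop) (e : nat).
Hypothesis baseK : galois_base K.
Hypothesis galL : galois_ext K L.
Implicit Types (sg : 'I_e -> E -> E) (s t : {rmorphism E -> E}).

Lemma base_ext : galois_base L.
Proof.
have [subL KL _] := galL; split=> //; last exact: base_enum baseK.
  by apply: (sep_closure_sub KL); case: baseK.
by move=> bad; have [a Ka na] := base_infinite baseK bad; exists a => //; apply: KL.
Qed.

Lemma Kaut_ext (s : E -> E) : Kaut L s -> Kaut K s.
Proof. by have [_ KL _] := galL; apply: Kaut_sub. Qed.

Lemma Kaut_cancel (t t' : E -> E) : Kaut K t -> cancel t t' -> cancel t' t -> Kaut K t'.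
Proof.
move=> tK tt' t't; have [u uK [tu ut]] := Kaut_inv tK.
by have -> : t' = u by apply: funext => x; rewrite -{1}(ut x) tt'.
Qed.

(* The group generated by the conjugates of the [sg nu] together with
   [Gal(L)]; its fixed field is [L[sg]_K]. *)
Inductive fixing_group sg : (E -> E) -> Prop :=
| fixing_id : fixing_group sg id
| fixing_L (g t : E -> E) : fixing_group sg g -> Kaut L t -> fixing_group sg (t \o g)
| fixing_conj (g c t t' : E -> E) nu : fixing_group sg g -> Kaut K t ->
    cancel t t' -> cancel t' t ->
    (c = sg nu \/ (cancel c (sg nu) /\ cancel (sg nu) c)) ->
    fixing_group sg (t' \o c \o t \o g).

Section OneFamily.

Variable sg : 'I_e -> E -> E.
Hypothesis sgK : forall nu, Kaut K (sg nu).

Lemma generator_Kaut c nu : c = sg nu \/ (cancel c (sg nu) /\ cancel (sg nu) c) -> Kaut K c.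
Proof. by case=> [->|[h1 h2]]; [apply: sgK|apply: Kaut_cancel (sgK nu) h2 h1]. Qed.

Lemma fixing_Kaut g : fixing_group sg g -> Kaut K g.
Proof.
elim=> [|{}g t _ gK /Kaut_ext tK|{}g c t t' nu _ gK tK tt' t't /generator_Kaut cK].
- exact: Kaut_id.
- exact: Kaut_comp.
exact: (Kaut_comp (Kaut_comp (Kaut_comp (Kaut_cancel tK tt' t't) cK) tK) gK).
Qed.

Lemma ngen_fixing g : ngen K sg g -> fixing_group sg g.
Proof.
elim=> [|{}g t t' c nu _ gZ tK tt' t't hc]; first exact: fixing_id.
exact: (fixing_conj gZ tK tt' t't hc).
Qed.

Lemma fixing_comp g h : fixing_group sg g -> fixing_group sg h -> fixing_group sg (g \o h).
Proof.
move=> gZ hZ; elim: gZ => [//|{}g t _ IH tL|{}g c t t' nu _ IH tK tt' t't hc].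
  exact: (fixing_L IH tL).
exact: (fixing_conj IH tK tt' t't hc).
Qed.

Lemma fixing_inv g : fixing_group sg g ->
  exists g', [/\ fixing_group sg g', cancel g g' & cancel g' g].
Proof.
elim=> [|{}g t _ [g' [IH gg' g'g]] tL|{}g c t t' nu _ [g' [IH gg' g'g]] tK tt' t't hc].
- by exists id; split=> //; apply: fixing_id.
- have [t' t'L [tt' t't]] := Kaut_inv tL; exists (g' \o t'); split.
  + by apply: (fixing_comp IH); apply: (fixing_L (fixing_id sg)).
  + exact: can_comp.
  + exact: can_comp.
have [c' [hc' cc' c'c]] : exists c', [/\ c' = sg nu \/ (cancel c' (sg nu) /\ cancel (sg nu) c'),
    cancel c c' & cancel c' c].
  case: hc => [->|[h1 h2]]; last by exists (sg nu); split=> //; left.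
  have [c' c'K [h1 h2]] := Kaut_inv (sgK nu).
  by exists c'; split=> //; right.
exists (g' \o (t' \o c' \o t)); split.
- by apply: (fixing_comp IH); apply: (fixing_conj (fixing_id sg) tK tt' t't hc').
- by move=> x /=; rewrite t't cc' tt' gg'.
- by move=> x /=; rewrite g'g t't c'c tt'.
Qed.

Lemma fixing_fixed_part g x : fixing_group sg g -> fixed_part K L sg x -> g x = x.
Proof.
move=> gZ [Lx cx]; elim: gZ => [//|{}g t _ IH [_ _ _ _ tL]|{}g c t t' nu _ IH tK tt' t't hc] /=.
  by rewrite IH tL.
rewrite IH; apply: (cx (t' \o c \o t)).
have h : ngen K sg (t' \o c \o t \o id) by apply: (ngen_step (ngen_id K sg) tK tt' t't hc).
split; first by apply: (fixing_Kaut (ngen_fixing h)).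
by move=> xs; exists (t' \o c \o t).
Qed.

Lemma fixed_part_fixing x : (forall g, fixing_group sg g -> g x = x) -> fixed_part K L sg x.
Proof.
move=> fx; split.
  apply: (base_fixed base_ext) => s sL; exact: (fx _ (fixing_L (fixing_id sg) sL)).
move=> tau [_ ht]; have [g gZ gx] := ht [:: x].
by rewrite gx ?mem_head // fx //; apply: ngen_fixing.
Qed.

Lemma fixed_part_sub x : K x -> fixed_part K L sg x.
Proof. by move=> Kx; apply: fixed_part_fixing => g /fixing_Kaut [_ _ _ _]; apply. Qed.

Lemma fixing_rmorphism g : fixing_group sg g ->
  exists s, s = g :> (E -> E) /\ Kaut K s.
Proof. by move=> /fixing_Kaut gK; have [s es] := Kaut_rmorphism gK; exists s; rewrite -es. Qed.

Lemma fixed_part_horner (p : {poly E}) x : (forall i, fixed_part K L sg p`_i) ->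
  fixed_part K L sg x -> fixed_part K L sg p.[x].
Proof.
move=> fp fx; apply: fixed_part_fixing => g gZ; have [s [es sK]] := fixing_rmorphism gZ.
have sx : s x = x by rewrite es (fixing_fixed_part gZ fx).
rewrite -es -horner_map sx.
by congr _.[_]; apply/polyP => i; rewrite coef_map /= es (fixing_fixed_part gZ (fp i)).
Qed.

Lemma transitive_irreducible (f : {poly {poly E}}) a :
  f \is monic -> (1 < size f)%N -> bi_over (fixed_part K L sg) f ->
  fixed_part K L sg a -> separable_poly (specialize f a) ->
  (forall v w, root (specialize f a) v -> root (specialize f a) w ->
     exists g, [/\ Kaut K g, forall x, fixed_part K L sg x -> g x = x & g v = w]) ->
  uni_irreducible (fixed_part K L sg) (specialize f a).
Proof.
move=> mf sf Mf Ma sepf tr; split.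
- by move=> i; rewrite coef_specialize; exact: (fixed_part_horner (Mf i) Ma).
- by rewrite size_specialize.
move=> g h Mg Mh eq; apply: contrapT => /not_orP [sg1 sh1].
have gf : g %| specialize f a by rewrite eq dvdp_mulr.
have hf : h %| specialize f a by rewrite eq dvdp_mull.
have [v rv] := divisor_root baseK sepf gf sg1.
have [w rw] := divisor_root baseK sepf hf sh1.
have [||s' [sK sM sv]] := tr v w; rewrite ?eq ?rootM ?rv ?rw ?orbT //.
have [s es] := Kaut_rmorphism sK; rewrite es in sM sv.
have sg' : map_poly s g = g by apply/polyP => i; rewrite coef_map /= sM.
have := root_map_fixed sg' rv; rewrite sv => rgw.
have cop : coprimep g h by apply: separable_coprime sepf _; rewrite eq.
by have := coprimep_root cop rgw; rewrite (rootP rw) eqxx.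
Qed.

Lemma fixed_irreducible_roots (f f1 : {poly {poly E}}) th a v :
  bi_irreducible (fixed_part K L sg) f -> f \is monic ->
  absolutely_irreducible f1 -> f1 %| f -> stable K th f1 ->
  root (specialize f a) v ->
  exists s, fixing_group sg s /\ root (specialize (act s f1) a) v.
Proof.
move=> [Mf f0 nuf irr] mf irr1 f1f st1; have [m1 s1 _ _] := irr1.
pose Z s := fixing_group sg s.
have ZK s : Z s -> Kaut K s by apply: fixing_Kaut.
(* [act s f1] depends only on s(th), so the conjugates of [f1] form a finite list indexed by the
   orbit of th. *)
have [o [uo ho]] := orbit_exists baseK th ZK.
have ht y : exists s, y \in o -> Z s /\ s th = y.
  have [/ho [s sK es]|ny] := boolP (y \in o); first by exists s.
  by exists idfun.
have {ht} /choice [tau tauP] := ht.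
pose hs := undup [seq act (tau y) f1 | y <- o].
have hsP h : h \in hs <-> exists2 s, Z s & h = act s f1.
  rewrite mem_undup; split=> [/mapP [y yo ->]|[s sZ ->]].
    by have [tZ _] := tauP _ yo; exists (tau y).
  have yo : s th \in o by apply/ho; exists s.
  have [tZ tth] := tauP _ yo; apply/mapP; exists (s th) => //.
  by apply: (act_stable st1 (ZK _ sZ) (ZK _ tZ)).
have act_f s : Z s -> act s f = f.
  move=> sZ; apply/polyP => i; rewrite coef_map /=; apply/polyP => j.
  by rewrite coef_map /= (fixing_fixed_part sZ (Mf i j)).
(* The product of the conjugates of [f1] is defined over [L[sg]_K], so it is [f]. *)
pose P := \prod_(h <- hs) h.
have irrhs h : h \in hs -> absolutely_irreducible h /\ h %| f.
  move/hsP => [s sZ ->]; split; first exact: act_absolutely_irreducible (ZK _ sZ) irr1.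
  by rewrite -(act_f s sZ); apply: act_dvdp.
have mP : P \is monic.
  by rewrite /P big_seq; apply: monic_prod => h /irrhs [[]].
have Pf : P %| f by apply: prod_absolutely_irreducible_dvdp; rewrite ?undup_uniq.
have f1hs : f1 \in hs.
  apply/hsP; exists idfun; first exact: (fixing_id sg).
  by rewrite act_id.
have act_P s : Z s -> act s P = P.
  move=> sZ; rewrite /act rmorph_prod /= -(big_map (act s) xpredT id); apply: perm_big.
  have us : uniq (map (act s) hs).
    rewrite map_inj_uniq ?undup_uniq // => A B /polyP eAB; apply/polyP => i.
    by have := eAB i; rewrite !coef_map => /map_poly_inj.
  have sub : {subset map (act s) hs <= hs}.
    move=> _ /mapP [h /hsP [t tZ ->] ->]; apply/hsP.
    have [u [eu uK]] := fixing_rmorphism (fixing_comp sZ tZ).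
    exists u; first by rewrite /Z eu; apply: fixing_comp.
    by rewrite -(act_comp f1 (u := u)) // => x; rewrite eu.
  apply: uniq_perm => //; first exact: undup_uniq.
  by have [] := uniq_min_size us sub; rewrite ?size_map.
have overM A : (forall s, Z s -> act s A = A) -> bi_over (fixed_part K L sg) A.
  move=> fA i j; apply: fixed_part_fixing => g gZ.
  have [s [es sK]] := fixing_rmorphism gZ.
  have : Z s by rewrite /Z es.
  by move/fA/polyP/(_ i)/polyP/(_ j); rewrite !coef_map /= es.
have /(Pdiv.IdomainMonic.dvdpP mP) [q eq] := Pf.
have mq : q \is monic by move: mf; rewrite eq monicMr.
have act_q s : Z s -> act s q = q.
  move=> sZ; apply: (mulIf (monic_neq0 mP)).
  by rewrite -{1}(act_P s sZ) -actM -eq act_f.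
have sP : (1 < size P)%N.
  apply: leq_trans s1 _; apply: dvdp_leq; first exact: monic_neq0.
  by rewrite /P (big_rem f1) //= dvdp_mulr.
have [[sq _]|[sP1 _]] := irr q P (overM _ act_q) (overM _ act_P) eq; last first.
  by rewrite sP1 in sP.
rewrite eq (monic_size1 mq sq) mul1r specializeE rmorph_prod /=.
rewrite -(big_map (fun h => specialize h a) xpredT id) => rv.
have /hasP [_ /mapP [h /hsP [s sZ ->] ->] rhv] :
    has (fun p => root p v) [seq specialize h a | h <- hs].
  by apply: contraTT rv; rewrite root_bigmul -all_predC.
by exists s.
Qed.

End OneFamily.

End FixedPart.

(** * Families for which M is not Hilbertian *)

Section BadFamilies.

Variables (E : fieldType) (K L : E -> Prop) (e : nat).
Hypothesis baseK : galois_base K.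
Hypothesis hilbK : hilbertian K.
Hypothesis galL : galois_ext K L.
Implicit Types (sg : 'I_e -> E -> E) (s t : {rmorphism E -> E}).

Local Notation M sg := (fixed_part K L sg).

(** In field terms, x lies in K(th). *)
Definition fixed_by th x := forall s : E -> E, Kaut K s -> s th = th -> s x = x.

Lemma agree_fixed th x (s s' : E -> E) : Kaut K s -> Kaut K s' -> s th = s' th ->
  fixed_by th x -> s x = s' x.
Proof.
move=> sK s'K eth fx; have [t tK [s't ts']] := Kaut_inv s'K.
have : (t \o s) x = x.
  by apply: fx => /=; [apply: Kaut_comp|rewrite eth s't].
by move=> /= /(congr1 s'); rewrite ts'.
Qed.

Lemma normal_conj th (t : E -> E) : normal_elt K th -> Kaut K t -> fixed_by th (t th).
Proof.
move=> nth tK s sK sth; have [t' et] := Kaut_rmorphism tK.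
have [s' es] := Kaut_rmorphism sK.
by rewrite et es; apply: nth; rewrite -?et -?es.
Qed.

(** As K(th)/K is Galois, agreement at th gives agreement at all conjugates of th. Replacing each
    [sg nu] by [sg' nu] in a word for g therefore does not change its value at th. *)
Lemma fixing_transfer sg sg' th g :
  (forall nu, Kaut K (sg nu)) -> (forall nu, Kaut K (sg' nu)) -> normal_elt K th ->
  (forall nu, sg nu th = sg' nu th) -> fixing_group K L sg g ->
  exists g', fixing_group K L sg' g' /\ g' th = g th.
Proof.
move=> sgK sgK' nth agr; have agr_conj nu (t : E -> E) : Kaut K t -> sg nu (t th) = sg' nu (t th).
  by move=> tK; apply: agree_fixed (agr nu) _ => //; apply: normal_conj.
elim=> [|{}g t _ [g' [IH gth]] tL|{}g c t t' nu gZ [g' [IH gth]] tK tt' t't hc].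
- by exists id; split=> //; apply: fixing_id.
- by exists (t \o g'); rewrite /= gth; split=> //; apply: (fixing_L IH tL).
have yK : Kaut K (t \o g) by apply: Kaut_comp => //; apply: (fixing_Kaut galL sgK gZ).
case: hc => [->|[h1 h2]].
  exists (t' \o sg' nu \o t \o g'); split.
    by apply: (fixing_conj IH tK tt' t't (nu := nu)); left.
  by rewrite /= gth -(agr_conj nu _ yK).
have [c' c'K [h3 h4]] := Kaut_inv (sgK' nu).
exists (t' \o c' \o t \o g'); split.
  by apply: (fixing_conj IH tK tt' t't (nu := nu)); right.
rewrite /= gth; congr t'.
have cK : Kaut K c by apply: (generator_Kaut sgK (nu := nu)); right.
have := agr_conj nu _ (Kaut_comp cK yK); rewrite /= h1 => {1}->.
by rewrite h3.
Qed.

Definition bad_for (f : {poly {poly E}}) (bl : seq E) sg :=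
  [/\ bi_irreducible (M sg) f, f \is monic, separable_poly f &
    forall a, M sg a -> uni_irreducible (M sg) (specialize f a) -> a \in bl].

Lemma root_conj (f1 : {poly {poly E}}) s a v : Kaut K s -> s a = a ->
  root (specialize (act s f1) a) v ->
  exists2 v1, root (specialize f1 a) v1 & s v1 = v.
Proof.
move=> sK sa rv; have [t [tK st ts]] := gal_inv sK; exists (t v) => //.
apply/rootP; apply: (fmorph_inj s); rewrite rmorph0 -horner_map /= ts.
by rewrite -act_specialize sa; apply/rootP.
Qed.

Lemma normal_stable (f1 : {poly {poly E}}) :
  exists th, normal_elt K th /\ stable K th f1.
Proof.
have [th nth hth] := normal_primitive baseK (flatten (map (@polyseq E) f1)).
exists th; split=> // s sK sth; apply/polyP => i; rewrite coef_map /=; apply/polyP => j.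
rewrite coef_map /=.
have [lti|gei] := ltnP i (size f1); last by rewrite (nth_default 0 gei) coef0 rmorph0.
have [ltj|gej] := ltnP j (size f1`_i); last by rewrite (nth_default 0 gej) rmorph0.
apply: (hth s sK sth); apply/flattenP; exists (f1`_i : seq E); last by rewrite mem_nth.
by apply/mapP; exists f1`_i; rewrite ?mem_nth.
Qed.

(** Only a lower bound on the number of conjugates of z over K(th); this makes it easy to
    increase. *)
Definition conj_over th z k := exists zs : seq E, [/\ uniq zs, (k <= size zs)%N &
  forall y, y \in zs -> exists s, [/\ Kaut K s, s th = th & s z = y]].

(** If x is not in K(th, z), then a generic z + c x has at least two conjugates above z and at least
    one above every other conjugate of z. *)
Lemma conj_over_grow sg th z x k s : (forall nu, Kaut K (sg nu)) ->
  M sg z -> M sg x -> conj_over th z k ->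
  Kaut K s -> s th = th -> s z = z -> s x <> x ->
  exists2 y, M sg y & conj_over th y k.+1.
Proof.
move=> sgK Mz Mx [zs [uzs szs hzs]] sK sth sz sx.
have ht y : exists t, y \in zs -> [/\ Kaut K t, t th = th & t z = y].
  have [/hzs [t ht]|ny] := boolP (y \in zs); first by exists t.
  by exists idfun.
have {ht} /choice [tau tauP] := ht.
pose ps := (z, x) :: (z, s x) :: [seq (y, tau y x) | y <- rem z zs].
have notin w : (z, w) \notin [seq (y, tau y x) | y <- rem z zs].
  by apply/negP => /mapP [y]; rewrite mem_rem_uniq // !inE => /andP [ny _] [ey _]; rewrite ey eqxx in ny.
have ups : uniq ps.
  rewrite /= inE negb_or !notin /= andbT xpair_eqE eqxx /= eq_sym.
  apply/andP; split; first exact/eqP.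
  by rewrite map_inj_uniq ?rem_uniq // => y y' [].
have [c [Kc _ uc]] := separating_coef baseK [::] ups.
exists (z + c * x).
  apply: (fixed_part_fixing baseK galL) => g gZ.
  have [t [et tK]] := fixing_rmorphism galL sgK gZ.
  rewrite -et rmorphD rmorphM /= et !(fixing_fixed_part galL sgK gZ) //.
  exact: (fixed_part_sub baseK galL sgK).
exists [seq u.1 + c * u.2 | u <- ps]; split=> //.
  rewrite size_map /= size_map.
  have [zin|nz] := boolP (z \in zs); last by rewrite rem_id // ltnS (leq_trans szs).
  by rewrite size_rem // prednK //; case: (zs) zin.
move=> _ /mapP [u + ->]; rewrite !inE => /or3P [/eqP ->|/eqP ->|/mapP [y + ->]] /=.
- by exists idfun; split=> //; apply: Kaut_id.
- by exists s; split=> //; rewrite rmorphD rmorphM /= sz (gal_fix sK Kc).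
move=> /mem_rem /tauP [tK tth tz]; exists (tau y); split=> //.
by rewrite rmorphD rmorphM /= tz (gal_fix tK Kc).
Qed.

Lemma bad_many_conjugates sg f bl f1 th0 : (forall nu, Kaut K (sg nu)) ->
  bad_for f bl sg -> absolutely_irreducible f1 -> f1 %| f -> stable K th0 f1 ->
  exists2 z, M sg z & conj_over th0 z (size f1).-1.
Proof.
move=> sgK [irrf mf sepf badf] irr1 f1f st1; apply: contrapT => nz.
have sf : (1 < size f)%N.
  case: irr1 => _ s1 _ _; apply: leq_trans s1 _; apply: dvdp_leq => //.
  exact: monic_neq0.
have exk : exists k, `[< forall z, M sg z -> ~ conj_over th0 z k >].
  by exists (size f1).-1; apply/asboolP => z Mz cz; apply: nz; exists z.
case: (ex_minnP exk) => k /asboolP hk min_k.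
(* The bound 0 is met by the empty list, so the least unattained bound is positive. *)
have [k' ek] : exists k', k = k'.+1.
  case: (k) hk => [h|k' _]; last by exists k'.
  by case: (h 0); [apply: (fixed_part_sub baseK galL sgK); case: (base_subfield baseK)|exists [::]].
have [z Mz cz] : exists2 z, M sg z & conj_over th0 z k'.
  apply: contrapT => h; have := min_k k'; rewrite ek ltnn => /(_ _)/negP; apply=> //.
  by apply/asboolP => z Mz cz; apply: h; exists z.
(* By maximality of [k'], the group fixing [th0] and [z] fixes all of [L[sg]_K]. *)
have [th2 hth2] := primitive_list baseK [:: th0; z].
have fix2 s : Kaut K s -> s th2 = th2 -> s th0 = th0 /\ s z = z.
  by move=> sK /(hth2 s sK) h; rewrite !h ?inE ?eqxx ?orbT.
have fixM s x : Kaut K s -> s th2 = th2 -> M sg x -> s x = x.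
  move=> sK sth2 Mx; have [sth0 sz] := fix2 s sK sth2.
  apply: contrapT => sx.
  have [y My] := conj_over_grow sgK Mz Mx cz sK sth0 sz sx.
  by rewrite -ek; apply: hk.
have st2 : stable K th2 f1 by move=> s sK sth2; apply: st1 => //; case: (fix2 s sK sth2).
have [badsep hbadsep] := separable_specialize_finite sepf.
have sep1 : separable_poly f1 by case: irr1.
(* K(th2) contains M, so transitivity over the stabilizer of th2 is obtained by automorphisms
   trivial on M; a lies in M because it lies in K. *)
have [a [Ka]] := hilbert_theta baseK hilbK (bl ++ badsep) (absolutely_irreducible_stable irr1 st2) sep1.
rewrite mem_cat negb_or => /andP [nbl nsep] _ tr.
case/negP: nbl; apply: badf; first exact: (fixed_part_sub baseK galL sgK).
have to1 v : root (specialize f a) v -> exists g v1, [/\ fixing_group K L sg g, root (specialize f1 a) v1 & g v1 = v].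
  move=> rv; have [s [sZ rsv]] := fixed_irreducible_roots baseK galL sgK irrf mf irr1 f1f st1 rv.
  have sK := fixing_Kaut galL sgK sZ.
  by have [v1 rv1 sv1] := root_conj sK (gal_fix sK Ka) rsv; exists s, v1.
apply: (transitive_irreducible baseK galL sgK) => //.
- by case: irrf.
- exact: (fixed_part_sub baseK galL sgK).
- exact: hbadsep.
move=> v w /to1 [g [v1 [gZ rv1 gv1]]] /to1 [h [w1 [hZ rw1 hw1]]].
have [s [sK sth svw]] := tr v1 w1 rv1 rw1.
have [g' [g'Z gg' g'g]] := fixing_inv sgK gZ.
have gK := fixing_Kaut galL sgK; have gM := fixing_fixed_part galL sgK.
exists (h \o (s \o g')); split.
- by apply: Kaut_comp (gK _ hZ) (Kaut_comp sK (gK _ g'Z)).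
- by move=> x Mx /=; rewrite (gM _ _ g'Z Mx) (fixM s x) // (gM _ _ hZ Mx).
by rewrite /= -gv1 gg' svw.
Qed.

Section Criterion.

Variables (sg0 : 'I_e -> E -> E) (f f1 : {poly {poly E}}) (th1 z0 : E).
Hypothesis sg0K : forall nu, Kaut K (sg0 nu).
Hypothesis irrf : bi_irreducible (M sg0) f.
Hypotheses (mf : f \is monic) (irr1 : absolutely_irreducible f1) (f1f : f1 %| f).
Hypotheses (nth1 : normal_elt K th1) (st1 : stable K th1 f1).
Hypotheses (Mz0 : M sg0 z0) (fz0 : fixed_by th1 z0).
Variables (i0 : 'I_e) (zs : seq E) (tau : E -> {rmorphism E -> E}).
Hypothesis tauK : forall z, Kaut K (tau z).

(** Irreducibility of f is assumed over the field of [sg0] only. By [fixing_transfer] the factors of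
    f and the membership of a carry over to [sg], and the equation [heq] links all roots of f(a,Y)
    to [w0]. *)
Lemma criterion sg a (b : {poly E}) rs w0 :
  (forall nu, Kaut K (sg nu)) -> (forall nu, sg nu th1 = sg0 nu th1) ->
  bi_over (M sg) f -> poly_over K b -> a = b.[z0] ->
  separable_poly (specialize f a) ->
  specialize f1 a = \prod_(v <- rs) ('X - v%:P) -> size rs = size zs ->
  map (sg i0) [seq tau u.1 u.2 | u <- zip zs rs] = [seq tau z w0 | z <- zs] ->
  M sg a /\ uni_irreducible (M sg) (specialize f a).
Proof.
move=> sgK agr Mf Kb ea sepf ers srs heq.
have fa : fixed_by th1 a.
  move=> s sK sth; have [s' es] := Kaut_rmorphism sK; have s'z : s' z0 = z0 by rewrite -es fz0.
  rewrite ea es -horner_map s'z; congr _.[_]; apply/polyP => i; rewrite coef_map /= -es.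
  by case: sK => _ _ _ _; apply.
have M0a : M sg0 a.
  rewrite ea; apply: (fixed_part_horner baseK galL sg0K) => // i.
  exact: (fixed_part_sub baseK galL sg0K).
have Ma : M sg a.
  apply: (fixed_part_fixing baseK galL) => g gZ.
  have [g0 [g0Z eg0]] := fixing_transfer sgK sg0K nth1 agr gZ.
  rewrite -(agree_fixed (fixing_Kaut galL sg0K g0Z) (fixing_Kaut galL sgK gZ) eg0 fa).
  exact: (fixing_fixed_part galL sg0K g0Z).
split=> //.
have gK := fixing_Kaut galL sgK; have gM := fixing_fixed_part galL sgK.
have sf : (1 < size f)%N.
  case: (irr1) => _ s1 _ _; apply: leq_trans s1 _; apply: dvdp_leq => //.
  exact: monic_neq0.
have rs_w0 v : v \in rs -> exists2 g, fixing_group K L sg g & g v = w0.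
  move=> vrs; have ltv : (index v rs < size zs)%N by rewrite -srs index_mem.
  pose z := nth 0 zs (index v rs).
  have hv : sg i0 (tau z v) = tau z w0.
    have := congr1 (fun l => nth 0 l (index v rs)) heq.
    rewrite (nth_map 0) ?size_map ?size_zip ?srs ?minnn //.
    rewrite (nth_map (0, 0)) ?size_zip ?srs ?minnn //.
    by rewrite (nth_map 0) // nth_zip ?srs //= nth_index.
  have [t [tK tt' t't]] := gal_inv (tauK z).
  exists (t \o sg i0 \o tau z \o id).
    by apply: (fixing_conj (fixing_id K L sg) (tauK z) tt' t't (nu := i0)); left.
  by rewrite /= hv tt'.
(* A root of f(a,Y) is first carried to a root of f1(a,Y) by the group of [sg], then to [w0]. *)
have to_w0 v : root (specialize f a) v -> exists2 g, fixing_group K L sg g & g v = w0.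
  move=> rv; have [s [sZ rsv]] := fixed_irreducible_roots baseK galL sg0K irrf mf irr1 f1f st1 rv.
  have agr' nu : sg0 nu th1 = sg nu th1 by rewrite agr.
  have [g [gZ eg]] := fixing_transfer sg0K sgK nth1 agr' sZ.
  have sK := fixing_Kaut galL sg0K sZ.
  have [g' [eg' g'K]] := fixing_rmorphism galL sgK gZ.
  have e1 : act s f1 = act g' f1 by apply: (act_stable st1 sK g'K); rewrite eg'.
  rewrite e1 in rsv; have g'a : g' a = a by rewrite eg'; apply: gM.
  have [v1 rv1 gv1] := root_conj g'K g'a rsv.
  have [|h hZ hv1] := rs_w0 v1; first by rewrite -root_prod_XsubC -ers.
  have [gi [giZ ggi gig]] := fixing_inv sgK gZ.
  exists (h \o gi); first exact: fixing_comp.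
  by rewrite /= -gv1 eg' ggi.
apply: (transitive_irreducible baseK galL sgK) => //.
move=> v w /to_w0 [g gZ gv] /to_w0 [h hZ hw].
have [h' [h'Z hh' h'h]] := fixing_inv sgK hZ.
have hgZ : fixing_group K L sg (h' \o g) by apply: fixing_comp.
exists (h' \o g); split; [exact: gK|by move=> x; apply: gM|].
by rewrite /= gv -hw hh'.
Qed.

End Criterion.

End BadFamilies.

(** * One stage: tuples of roots and the excluded tuple *)

Section Tuples.

Variable T : eqType.

Fixpoint all_tuples (zss : seq (seq T)) : seq (seq T) :=
  if zss is zs :: zss' then [seq z :: vs | z <- zs, vs <- all_tuples zss'] else [:: [::]].

Lemma mem_all_tuples zss vs : (vs \in all_tuples zss) = tuple_of zss vs.
Proof.
elim: zss vs => [|zs zss IH] vs /=; first by case: vs => [|v vs]; rewrite inE.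
apply/allpairsP/idP => [[[z ws] /= [zzs wsin ->]]|]; first by rewrite /= zzs -IH.
by case: vs => [//|v vs] /andP [vz]; rewrite -/(tuple_of _ _) -IH => h; exists (v, vs).
Qed.

Lemma uniq_all_tuples zss : (forall zs, zs \in zss -> uniq zs) -> uniq (all_tuples zss).
Proof.
elim: zss => [//|zs zss IH] h /=; apply: allpairs_uniq.
- by apply: h; rewrite mem_head.
- by apply: IH => zs' h'; apply: h; rewrite inE h' orbT.
by move=> [? ?] [? ?] _ _ /= [-> ->].
Qed.

Lemma size_all_tuples zss n : (forall zs, zs \in zss -> size zs = n) ->
  size (all_tuples zss) = (n ^ size zss)%N.
Proof.
elim: zss => [//|zs zss IH] h /=; rewrite size_allpairs IH => [|zs' h'].
  by rewrite h ?mem_head // expnS.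
by apply: h; rewrite inE h' orbT.
Qed.

End Tuples.

Section Stage.

Variables (E : fieldType) (K L : E -> Prop) (e : nat).
Hypothesis baseK : galois_base K.
Hypothesis hilbK : hilbertian K.
Hypothesis galL : galois_ext K L.
Implicit Types (sg : 'I_e -> E -> E) (s t : {rmorphism E -> E}).

Local Notation M sg := (fixed_part K L sg).

Lemma fixed_by_conj th x (t : E -> E) : normal_elt K th -> Kaut K t ->
  fixed_by K th x -> fixed_by K th (t x).
Proof.
move=> nth tK fx s sK sth; have [t' t'K [tt' t't]] := Kaut_inv tK.
have : (t' \o (s \o t)) x = x.
  apply: fx; first exact: (Kaut_comp t'K (Kaut_comp sK tK)).
  by rewrite /= (normal_conj nth tK sK sth) tt'.
by move=> /= /(congr1 t); rewrite t't.
Qed.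

Lemma all2_root_zip (P : E -> {poly E}) (h : E -> E -> E) zs rs :
  size rs = size zs ->
  (forall z v, z \in zs -> v \in rs -> root (P z) (h z v)) ->
  all2 root [seq P z | z <- zs] [seq h u.1 u.2 | u <- zip zs rs].
Proof.
elim: zs rs => [|z zs IH] [|v rs] //= [sz] hP.
rewrite hP ?mem_head // IH // => z' v' h1 h2.
by apply: hP; rewrite inE ?h1 ?h2 orbT.
Qed.

Lemma all2_root_map2 (P : E -> {poly E}) (h : E -> E) (zs : seq E) :
  (forall z, z \in zs -> root (P z) (h z)) ->
  all2 root [seq P z | z <- zs] [seq h z | z <- zs].
Proof.
elim: zs => [//|z zs IH] hP /=; rewrite hP ?mem_head // IH // => z' h1.
by apply: hP; rewrite inE h1 orbT.
Qed.

Variables (sg0 : 'I_e -> E -> E) (f f1 : {poly {poly E}}) (bl : seq E) (th0 th1 z0 : E).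
Hypothesis sg0K : forall nu, Kaut K (sg0 nu).
Hypothesis irrf : bi_irreducible (M sg0) f.
Hypotheses (mf : f \is monic) (sepf : separable_poly f).
Hypotheses (irr1 : absolutely_irreducible f1) (f1f : f1 %| f).
Hypotheses (nth0 : normal_elt K th0) (st0 : stable K th0 f1).
Hypotheses (nth1 : normal_elt K th1) (fth0 : fixed_by K th1 th0).
Hypotheses (Mz0 : M sg0 z0) (fz0 : fixed_by K th1 z0).
Variables (i0 : 'I_e) (zs : seq E) (tau : E -> {rmorphism E -> E}).
Hypotheses (uzs : uniq zs) (szs : size zs = (size f1).-1).
Hypothesis tauP : forall z, [/\ Kaut K (tau z), tau z th0 = th0 & z \in zs -> tau z z0 = z].

(** [ys] consists of the tau_i v_i and [ws] of the tau_i w0; [W] is the set of all tuples of roots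
    of the f1(tau_i a,Y), which is the orbit of [ys] over the stabilizer of [Y]. A bad family cannot
    send [ys] to [ws], by [criterion]. *)
Lemma stage (Y : seq E) : th1 \in Y -> exists ys ws W, [/\
  uniq W, size W = (size zs ^ size zs)%N,
  forall w, w \in W <-> exists s, [/\ Kaut K s, fixes s Y & map s ys = w],
  forall s, Kaut K s -> s th1 = sg0 i0 th1 -> exists2 w, w \in W & map s w = ws &
  forall sg, (forall nu, Kaut K (sg nu)) -> (forall nu, sg nu th1 = sg0 nu th1) ->
    bad_for K L f bl sg -> map (sg i0) ys <> ws].
Proof.
move=> th1Y; have [m1 s1 sep1 _] := irr1.
have tauK z : Kaut K (tau z) by case: (tauP z).
have [th hth] := primitive_list baseK Y.
have thth1 s : Kaut K s -> s th = th -> s th1 = th1.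
  by move=> sK /(hth s sK)/(_ _ th1Y).
have st1 : stable K th1 f1.
  by move=> s sK sth1; apply: st0 => //; apply: fth0.
have fzs z : z \in zs -> fixed_by K th1 z.
  by move=> zin; have [tK _ <- //] := tauP z; apply: fixed_by_conj.
have [z1 z1in] : exists z1, z1 \in zs.
  case: (zs) szs => [|z1 zs' _]; last by exists z1; rewrite mem_head.
  by case: (size f1) s1 => [|[|n]].
have [badsep hbadsep] := separable_specialize_finite sepf.
have stf1 : stable K th f1 by move=> s sK sth; apply: st1 => //; apply: thth1.
have fzs' s z : Kaut K s -> s th = th -> z \in zs -> s z = z.
  by move=> sK sth zin; apply: fzs => //; apply: thth1.
(* The value b(z1) is the conjugate of a under [tau z1]; keeping it off the image of the forbidden
   list keeps a off the list. *)
have [b [Kb hb jb]] := conjugate_points baseK hilbK (map (tau z1) (bl ++ badsep)) irr1 stf1 uzs fzs'.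
pose a := b.[z0].
have fixb s : Kaut K s -> map_poly s b = b.
  by move=> sK; apply/polyP => i; rewrite coef_map /= (gal_fix sK).
have tau_a z : z \in zs -> tau z a = b.[z].
  by move=> zin; have [tK _ tz] := tauP z; rewrite /a -horner_map /= tz // fixb.
have [nbl nsep] : a \notin bl /\ a \notin badsep.
  have [+ _] := hb z1 z1in; rewrite -tau_a //; rewrite mem_map; last exact: fmorph_inj.
  by rewrite mem_cat negb_or => /andP [].
have sepfa : separable_poly (specialize f a) by apply: hbadsep.
have sepf1a : separable_poly (specialize f1 a).
  by apply: dvdp_separable sepfa; apply: specialize_dvdp.
have [rs urs ers] := base_split baseK (specialize_monic a m1) sepf1a.
have srs : size rs = size zs.
  have := size_specialize a m1; rewrite ers size_prod_XsubC szs => e1.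
  by rewrite -e1.
have M0a : M sg0 a.
  apply: (fixed_part_horner baseK galL sg0K) => // i.
  exact: (fixed_part_sub baseK galL sg0K).
have fa : fixed_by K th1 a.
  move=> s sK sth; have [s' es] := Kaut_rmorphism sK.
  have s'z : s' z0 = z0 by rewrite -es fz0.
  rewrite /a es -horner_map s'z /= fixb //; by rewrite -es.
have [sr esr] := Kaut_rmorphism (sg0K i0).
have srK : Kaut K sr by rewrite -esr.
(* The conjugate of sigma_0 by [tau z] fixes M, hence a; so sigma_0 fixes the image of a under
   [tau z]. *)
have conj_in z : sr (tau z a) = tau z a.
  have [t [tK tt' t't]] := gal_inv (tauK z).
  have gZ : fixing_group K L sg0 (t \o sg0 i0 \o tau z \o id).
    by apply: (fixing_conj (fixing_id K L sg0) (tauK z) tt' t't (nu := i0)); left.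
  have := fixing_fixed_part galL sg0K gZ M0a; rewrite /= esr => /(congr1 (tau z)).
  by rewrite t't.
have sr_a : sr a = a.
  have gZ : fixing_group K L sg0 (id \o sg0 i0 \o id \o id).
    by apply: (fixing_conj (fixing_id K L sg0) (Kaut_id K) _ _ (nu := i0)) => //; left.
  by have := fixing_fixed_part galL sg0K gZ M0a; rewrite /= esr.
have [v0 v0rs] : exists v, v \in rs.
  case: (rs) srs => [|v rs' _]; last by exists v; rewrite mem_head.
  by case: (zs) z1in.
have root_rs v : v \in rs -> root (specialize f1 a) v by rewrite ers root_prod_XsubC.
(* sigma_0 may move the coefficients of [f1]; any automorphism agreeing with it at th1 takes [f1] to
   [fs], so the target [w0] is a root of fs(a,Y). *)
pose fs := act sr f1; pose w0 := sr v0.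
have rw0 : root (specialize fs a) w0.
  rewrite -{1}sr_a act_specialize; apply/rootP.
  by rewrite horner_map (rootP (root_rs _ v0rs)) rmorph0.
pose ys := [seq tau u.1 u.2 | u <- zip zs rs].
pose ws := [seq tau z w0 | z <- zs].
pose ps := [seq specialize f1 b.[z] | z <- zs].
have rys : all2 root ps ys.
  apply: (all2_root_zip (P := fun z => specialize f1 b.[z]) (h := fun z v => tau z v)) => //.
  move=> z v zin vrs; have [tK tth0 _] := tauP z.
  rewrite -tau_a // -{1}(st0 tK tth0) act_specialize; apply/rootP.
  by rewrite horner_map (rootP (root_rs _ vrs)) rmorph0.
have [|zss ezss hzss] := @split_all _ _ baseK ps (size zs).
  move=> _ /mapP [z zin ->]; split; first exact: specialize_monic.
    by case: (hb z zin).
  by rewrite size_specialize // szs prednK // ltnW.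
have WP w : w \in all_tuples zss = all2 root ps w.
  by rewrite mem_all_tuples (tuple_of_roots _ ezss).
exists ys, ws, (all_tuples zss); split.
- by apply: uniq_all_tuples => zs'' /hzss [].
- rewrite (@size_all_tuples _ _ (size zs)); last by move=> zs'' /hzss [].
  by have := congr1 size ezss; rewrite /ps !size_map => ->.
- move=> w; rewrite WP; split=> [rw|[s [sK fsY <-]]].
    by have [s [sK sth sw]] := jb ys w rys rw; exists s; split=> //; apply/hth.
  have sth1 : s th1 = th1 by apply: fsY.
  apply: all2_root_map rys => _ /mapP [z zin ->].
  apply: (specialize_fixed st1 sK sth1); rewrite -horner_map /= fixb //.
  by rewrite (fzs z zin s).
- move=> s sK sth1; have [t [tK st ts]] := gal_inv sK.
  exists (map t ws); last by rewrite -map_comp map_id_in // => x _ /=; rewrite ts.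
  rewrite WP /ps /ws -map_comp; apply: all2_root_map2 => z zin /=.
  have [tauzK tth0 _] := tauP z.
  have es : act s f1 = fs by apply: (act_stable st1) => //; rewrite sth1 esr.
  have sa : s (tau z a) = tau z a.
    rewrite -[RHS](conj_in z).
    apply: (agree_fixed (th := th1) sK srK); first by rewrite sth1 esr.
    exact: fixed_by_conj.
  (* [tau z] fixes th0 and, K(th0) being Galois, also sr(th0), which controls [fs]. *)
  have efs : act (tau z) fs = fs.
    have [u [uK eu]] := gal_comp tauzK srK.
    rewrite -(act_comp f1 eu); apply: (act_stable st0 uK srK).
    by rewrite eu; apply: nth0.
  have rtz : root (specialize (act s f1) (tau z a)) (tau z w0).
    rewrite es -efs act_specialize; apply/rootP.
    by rewrite horner_map (rootP rw0) rmorph0.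
  have [v1 rv1 sv1] := root_conj sK sa rtz.
  by rewrite -tau_a // -sv1 st.
move=> sg sgK agr [irr' _ _ bad'] heq.
case/negP: nbl; have Mf : bi_over (M sg) f by case: irr'.
have [Ma irra] := criterion baseK galL sg0K irrf mf irr1 f1f nth1 st1 Mz0 fz0
  tauK sgK agr Mf Kb (erefl a) sepfa ers srs heq.
exact: bad'.
Qed.

End Stage.

(** * Null sets *)

Section Measure.

Variables (E : fieldType) (K : E -> Prop) (e : nat).
Hypothesis baseK : galois_base K.
Implicit Types (S T : ('I_e -> E -> E) -> Prop) (sg : 'I_e -> E -> E).

Record coset := Coset {
  coset_pts : seq E;
  coset_rho : 'I_e -> E -> E;
  coset_index : nat;
  coset_rhoP : forall i, Kaut K (coset_rho i);
  coset_indexP : orbit_size K coset_pts coset_index }.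

Definition in_coset (c : coset) sg :=
  forall i x, x \in coset_pts c -> sg i x = coset_rho c i x.

Definition weight (c : coset) : rat := ((coset_index c ^ e)%N%:R)^-1.

Definition total (l : seq coset) : rat := \sum_(c <- l) weight c.

(** Covers are finite here; infinite sequences of cosets enter only with the countable union. *)
Definition null_set S := forall eps : rat, 0 < eps -> exists l : seq coset,
  (forall sg, (forall i, Kaut K (sg i)) -> S sg -> exists2 c, List.In c l & in_coset c sg) /\
  total l < eps.

Lemma weight_ge0 c : 0 <= weight c.
Proof. by rewrite invr_ge0 ler0n. Qed.

Lemma total_cat l l' : total (l ++ l') = total l + total l'.
Proof. exact: big_cat. Qed.

Lemma null_set_sub S T : (forall sg, S sg -> T sg) -> null_set T -> null_set S.
Proof.
move=> ST nT eps e0; have [l [hl tl]] := nT eps e0; exists l; split=> // sg sgK /ST.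
exact: hl.
Qed.

Lemma sum_nth_total (c0 : coset) (l : seq coset) m : (m <= size l)%N ->
  \sum_(n < m) weight (nth c0 l n) <= total l.
Proof.
move=> ml; rewrite /total (big_nth c0) -(big_mkord xpredT (fun n => weight (nth c0 l n))).
by rewrite [leRHS](big_cat_nat (n := m)) //= lerDl sumr_ge0 // => i _; apply: weight_ge0.
Qed.

Lemma sum_half (eps : rat) m : 0 < eps -> \sum_(i < m) eps / 2 ^+ i.+1 < eps.
Proof.
move=> e0; have -> : \sum_(i < m) eps / 2 ^+ i.+1 = eps - eps / 2 ^+ m.
  elim: m => [|m IH]; first by rewrite big_ord0 expr0 divr1 subrr.
  rewrite big_ord_recr /= IH exprS invfM mulrA.
  set x := 2 ^- m; have -> : eps / 2 * x = eps * x / 2 by rewrite mulrAC.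
  by rewrite -addrA; congr (_ + _); lra.
by rewrite gtrDl oppr_lt0 divr_gt0 // exprn_gt0.
Qed.

Lemma nth_flatten_prefix (c0 : coset) (l : nat -> seq coset) n m m' :
  (m <= m')%N -> (n < size (flatten [seq l i | i <- iota 0 m]))%N ->
  nth c0 (flatten [seq l i | i <- iota 0 m']) n = nth c0 (flatten [seq l i | i <- iota 0 m]) n.
Proof.
by move=> /subnKC <- hn; rewrite iotaD map_cat flatten_cat nth_cat hn.
Qed.

(** The finite covers are concatenated. A coset of small weight is added to each, so that no list is
    empty and the concatenation is an infinite sequence. *)
Lemma null_countable_union (small_cosets : forall eps : rat, 0 < eps -> exists c, weight c < eps)
    (S : ('I_e -> E -> E) -> Prop) (T : nat -> ('I_e -> E -> E) -> Prop) :
  (forall n, null_set (T n)) ->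
  (forall sg, (forall i, Kaut K (sg i)) -> S sg -> exists n, T n sg) ->
  haar_null K S.
Proof.
move=> nT ST eps e0.
(* Half of the allowance eps / 2^(i+1) goes to the cover of [T i], half to the added coset. *)
have epos i : 0 < eps / 2 ^+ i.+2 by rewrite divr_gt0 // exprn_gt0.
have hl i : exists l : seq coset, [/\ (0 < size l)%N,
   forall sg, (forall i, Kaut K (sg i)) -> T i sg -> exists2 c, List.In c l & in_coset c sg &
   total l <= eps / 2 ^+ i.+1].
  have [l [cl tl]] := nT i _ (epos i); have [c wc] := small_cosets _ (epos i).
  exists (c :: l); split=> //.
    by move=> sg sgK Tsg; have [c' c'l hc'] := cl sg sgK Tsg; exists c' => //; right.
  rewrite /total big_cons -/(total l).
  have -> : eps / 2 ^+ i.+1 = eps / 2 ^+ i.+2 + eps / 2 ^+ i.+2.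
    rewrite [2 ^+ i.+2]exprS invfM mulrA; set x := 2 ^- _.
    by have -> : eps / 2 * x = eps * x / 2; [rewrite mulrAC|lra].
  by apply: ltW; apply: ltrD.
have {hl} /choice [l hl] := hl.
have [c0 _] := small_cosets _ e0.
pose P m := flatten [seq l i | i <- iota 0 m].
have sP m : (m <= size (P m))%N.
  elim: m => [//|m IH]; rewrite /P -addn1 iotaD map_cat flatten_cat size_cat /= cats0 add0n.
  by rewrite leq_add //; case: (hl m).
have tP m : total (P m) < eps.
  apply: le_lt_trans (sum_half m e0).
  elim: m => [|m IH]; first by rewrite /total big_nil big_ord0.
  rewrite /P -addn1 iotaD map_cat flatten_cat total_cat /= cats0 add0n addn1.
  rewrite big_ord_recr /=; apply: lerD => //; by case: (hl m).
(* The first n + 1 lists have at least n + 1 entries in all, so the default [c0] is never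
   reached. *)
pose cs n := nth c0 (P n.+1) n.
have csP n m : (n < m)%N -> cs n = nth c0 (P m) n.
  by move=> nm; rewrite /cs /P [RHS](@nth_flatten_prefix c0 l n n.+1) // -/(P _) sP.
exists (fun n => coset_pts (cs n)), (fun n => coset_rho (cs n)), (fun n => coset_index (cs n)).
split=> [n i|n|sg sgK Ssg|m].
- exact: coset_rhoP.
- exact: coset_indexP.
- have [i Tsg] := ST sg sgK Ssg; have [_ /(_ sg sgK Tsg) [c cl hc] _] := hl i.
  have [j ltj ej] : exists2 j, (j < size (P i.+1))%N & nth c0 (P i.+1) j = c.
    have : List.In c (P i.+1).
      rewrite /P -addn1 iotaD map_cat flatten_cat /= cats0 add0n.
      by apply/List.in_app_iff; right.
    elim: (P i.+1) => [//|d l' IH] /= [->|/IH [j h1 h2]]; first by exists 0%N.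
    by exists j.+1.
  exists j; suff -> : cs j = c by [].
  case: (leqP j.+1 i.+1) => h; first by rewrite (csP _ _ h).
  by rewrite /cs -ej /P (@nth_flatten_prefix c0 l j i.+1) // ltnW.
apply: le_lt_trans (tP m); apply: le_trans (sum_nth_total c0 (sP m)).
by apply: ler_sum => n _; rewrite -(csP n m).
Qed.

Definition is_orbit (Y : seq E) (t : seq (seq E)) :=
  uniq t /\ forall y, y \in t <-> exists2 s : E -> E, Kaut K s & y = map s Y.

(* Only the component [i0] is constrained by [B], so the cosets of [Y] that
   meet [T] make up a proportion [size B / size t] of all of them. *)
Lemma cylinder_cover (i0 : 'I_e) T Y t (B : seq (seq E)) :
  is_orbit Y t -> {subset B <= t} -> (0 < size t)%N ->
  (forall sg, (forall i, Kaut K (sg i)) -> T sg -> map (sg i0) Y \in B) ->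
  exists l : seq coset,
    (forall sg, (forall i, Kaut K (sg i)) -> T sg -> exists2 c, List.In c l & in_coset c sg) /\
    total l <= (size B)%:R / (size t)%:R.
Proof.
move=> [ut ht] Bt t0 TB; set N := size t in t0 *.
have hg y : exists s : E -> E, Kaut K s /\ (y \in t -> y = map s Y).
  have [/ht [s sK ->]|ny] := boolP (y \in t); first by exists s.
  by exists id; split=> //; apply: Kaut_id.
have {hg} /choice [gam gamP] := hg.
have orbY : orbit_size K Y N by exists t.
pose mk (phi : {ffun 'I_e -> 'I_N}) := @Coset Y (fun i => gam (nth [::] t (phi i))) N
   (fun i => (gamP _).1) orbY.
pose J := [set j : 'I_N | nth [::] t j \in B].
pose F (i : 'I_e) := [pred j : 'I_N | (i == i0) ==> (j \in J)].
pose A := family F.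
exists [seq mk phi | phi <- enum A]; split.
  move=> sg sgK Tsg.
  have yt i : map (sg i) Y \in t by apply/ht; exists (sg i).
  have lti i : (index (map (sg i) Y) t < N)%N by rewrite index_mem.
  pose phi : {ffun 'I_e -> 'I_N} := [ffun i => Ordinal (lti i)].
  exists (mk phi).
    apply: List.in_map; have : phi \in enum A.
      rewrite mem_enum; apply/familyP => i; rewrite ffunE.
      by rewrite inE; apply/implyP => /eqP ->; rewrite inE /= nth_index // TB.
    elim: (enum A) => [//|x l IH]; rewrite inE => /orP [/eqP ->|/IH]; first by left.
    by right.
  move=> i x xY /=; rewrite ffunE /= nth_index //.
  have := (gamP (map (sg i) Y)).2 (yt i) => /(congr1 (fun l => nth 0 l (index x Y))).
  by rewrite !(nth_map 0) ?index_mem // nth_index.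
have cJ : (#|J| <= size B)%N.
  rewrite cardE -(size_map (fun j : 'I_N => nth [::] t j)); apply: uniq_leq_size.
    rewrite map_inj_in_uniq ?enum_uniq // => j j' _ _ /eqP.
    by rewrite nth_uniq // => /eqP /val_inj.
  by move=> _ /mapP [j + ->]; rewrite mem_enum inE.
(* The other e - 1 components are free. *)
have cA : #|A| = (#|J| * N ^ e.-1)%N.
  rewrite card_family foldrE big_image /= (bigD1 i0) //=; congr (_ * _)%N.
    by apply: eq_card => j; rewrite unfold_in /= eqxx.
  rewrite (eq_bigr (fun=> N)) => [|i /negbTE ni]; last first.
    by rewrite -[RHS]card_ord; apply: eq_card => j; rewrite unfold_in /= ni.
  rewrite prod_nat_const; congr (_ ^ _)%N.
  by rewrite (eq_card (B := predC1 i0)) // cardC1 card_ord.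
have e0 : (0 < e)%N by apply: leq_ltn_trans (ltn_ord i0).
rewrite /total big_map /weight /=.
rewrite big_const_seq count_predT -cardE iter_addr_0 cA -[_ *+ _]mulr_natl.
have -> : (N ^ e)%N = (N ^ e.-1 * N)%N by rewrite -expnSr prednK.
rewrite !natrM invfM mulrA mulrK ?unitfE ?pnatr_eq0 -?lt0n ?expn_gt0 ?t0 //.
by rewrite ler_pM2r ?invr_gt0 ?ltr0n // ler_nat.
Qed.

(** Bernoulli's inequality with denominators cleared: (d / (d+1))^n is at most d / (d+n), so it
    tends to 0. *)
Lemma pow_ratio_bound d n : (d ^ n * (d + n) <= (d.+1) ^ n * d)%N.
Proof.
elim: n => [|n IH]; first by rewrite !expn0 addn0.
rewrite !expnS.
have h : (d ^ n <= d.+1 ^ n)%N by elim: (n) => // m h; rewrite !expnS leq_mul.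
nia.
Qed.

(* Independent stages: at each of them the images of the new points [ys]
   under automorphisms fixing [Y] are the [d.+1] elements of [W], exactly one
   of which is excluded for the members of [T]. *)
Lemma independent_stages (i0 : 'I_e) T (th1 y1 : E) (d : nat) :
  (exists2 s : E -> E, Kaut K s & s th1 = y1) ->
  (forall sg, (forall i, Kaut K (sg i)) -> T sg -> sg i0 th1 = y1) ->
  (forall Y : seq E, th1 \in Y -> exists ys ws W, [/\
     uniq W, size W = d.+1,
     forall w, w \in W <-> exists s : {rmorphism E -> E},
       [/\ Kaut K s, fixes s Y & map s ys = w],
     forall s : {rmorphism E -> E}, Kaut K s -> s th1 = y1 ->
       exists2 w, w \in W & map s w = ws &
     forall sg, (forall nu, Kaut K (sg nu)) -> T sg -> map (sg i0) ys <> ws]) ->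
  null_set T.
Proof.
move=> [s1 s1K es1] T1 stages.
(* After n stages [B] holds the images of [Y] still possible for a member of [T], a proportion of at
   most (d / (d+1))^n of the orbit [t]. *)
have levels n : exists Y t B, [/\ th1 \in Y, is_orbit Y t, (0 < size t)%N /\ {subset B <= t},
    forall s : E -> E, Kaut K s -> map s Y \in B -> s th1 = y1 &
    (forall sg, (forall i, Kaut K (sg i)) -> T sg -> map (sg i0) Y \in B) /\
    (size B * d.+1 ^ n <= d ^ n * size t)%N].
  elim: n => [|n [Y [t [B [th1Y [ut ht] [t0 Bt] Bth1 [TB szB]]]]]].
    have [o [uo ho]] := orbit_exists baseK th1 (fun (s : {rmorphism E -> E}) (h : Kaut K s) => h).
    have [s1' es1'] := Kaut_rmorphism s1K.
    have y1o : y1 \in o by apply/ho; exists s1'; rewrite -es1'.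
    exists [:: th1], [seq [:: y] | y <- o], [:: [:: y1]]; split.
    - by rewrite mem_head.
    - split; first by rewrite map_inj_uniq // => ? ? [].
      move=> y; split=> [/mapP [z /ho [s sK <-] ->]|[s sK ->]]; first by exists s.
      have [s' es] := Kaut_rmorphism sK; apply/mapP; exists (s th1) => //.
      by apply/ho; exists s'; rewrite -es.
    - split; first by rewrite size_map; case: (o) y1o.
      by move=> y; rewrite inE => /eqP ->; apply: map_f.
    - by move=> s sK /=; rewrite inE => /eqP [].
    split=> [sg sgK Tsg|]; first by rewrite /= T1 // mem_head.
    by rewrite !expn0 muln1 mul1n size_map; case: (o) y1o.
  have [ys [ws [W [uW sW hW exW TW]]]] := stages Y th1Y.
  have hg y : exists s : {rmorphism E -> E}, Kaut K s /\ (y \in t -> y = map s Y).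
    have [/ht [s sK ->]|ny] := boolP (y \in t); last first.
      by exists idfun; split=> //; apply: Kaut_id.
    by have [s' es] := Kaut_rmorphism sK; exists s'; rewrite -es.
  have {hg} /choice [gam gamP] := hg.
  have gamK y : Kaut K (gam y) by case: (gamP y).
  have decomp (s : E -> E) : Kaut K s -> map s Y \in t ->
      exists2 w, w \in W & map s ys = map (gam (map s Y)) w.
    move=> sK yt; have [s' es] := Kaut_rmorphism sK.
    have [g [gK gg' g'g]] := gal_inv (gamK (map s Y)).
    have s'K : Kaut K s' by rewrite -es.
    have [u [uK eu]] := gal_comp gK s'K.
    have ey := (gamP (map s Y)).2 yt.
    exists (map u ys).
      apply/hW; exists u; split=> // x xY; rewrite eu -es.
      have := congr1 (fun l => nth 0 l (index x Y)) ey.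
      by rewrite !(nth_map 0) ?index_mem // nth_index // => ->; rewrite gg'.
    by rewrite -map_comp; apply: eq_map => x /=; rewrite eu g'g es.
  (* Above the image y of [Y], the images of [ys] are the translates of [W] by [gam y]; the one
     equal to [ws] is removed. *)
  pose Wb y := [seq w <- W | map (gam y) w != ws].
  exists (Y ++ ys), [seq y ++ map (gam y) w | y <- t, w <- W],
    [seq y ++ map (gam y) w | y <- B, w <- Wb y]; split.
  - by rewrite mem_cat th1Y.
  - split.
      apply: allpairs_uniq_dep => // -[y w] [y' w'].
      move=> /allpairsPdep [a [b [at_ bW [-> ->]]]] /allpairsPdep [a' [b' [a't b'W [-> ->]]]] /= /eqP.
      rewrite eqseq_cat; last by rewrite ((gamP a).2 at_) ((gamP a').2 a't) !size_map.
      case/andP => /eqP eaa; rewrite eaa => /eqP /(inj_map (@fmorph_inj _ _ (gam a'))) -> //.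
    move=> z; split=> [/allpairsPdep [y [w [yt /hW [s [sK fY <-]] ->]]]|[s sK ->]].
      have [u [uK eu]] := gal_comp (gamK y) sK; exists u => //.
      rewrite map_cat -map_comp; congr (_ ++ _); last by apply: eq_map => x /=; rewrite eu.
      by rewrite {1}((gamP y).2 yt); apply/eq_in_map => x xY /=; rewrite eu fY.
    have yt : map s Y \in t by apply/ht; exists s.
    have [w wW ew] := decomp s sK yt.
    by apply/allpairsPdep; exists (map s Y), w; rewrite map_cat ew.
  - split; first by rewrite size_allpairs sW muln_gt0 t0.
    move=> z /allpairsPdep [y [w [yB]]]; rewrite mem_filter => /andP [_ wW] ->.
    by apply/allpairsPdep; exists y, w; rewrite (Bt y yB).
  - move=> s sK /allpairsPdep [y [w [yB _ /eqP]]].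
    rewrite map_cat eqseq_cat; last by rewrite ((gamP y).2 (Bt y yB)) !size_map.
    by case/andP => /eqP ey _; apply: Bth1 => //; rewrite ey.
  split=> [sg sgK Tsg|].
    have yB := TB sg sgK Tsg; have [w wW ew] := decomp _ (sgK i0) (Bt _ yB).
    apply/allpairsPdep; exists (map (sg i0) Y), w; split=> //; last by rewrite map_cat ew.
    by rewrite mem_filter wW andbT -ew; apply/eqP/TW.
  have Wbd y : y \in B -> (size (Wb y) <= d)%N.
    move=> yB; have gth1 : gam y th1 = y1.
      by apply: Bth1 => //; rewrite -((gamP y).2 (Bt y yB)).
    have [w wW ew] := exW (gam y) (gamK y) gth1.
    have : has (fun w => map (gam y) w == ws) W by apply/hasP; exists w; rewrite // ew.
    rewrite has_count => hc; rewrite size_filter -ltnS -sW.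
    by rewrite -(count_predC (fun w => map (gam y) w == ws) W) -[X in (X < _)%N]add0n ltn_add2r.
  have sB' : (size [seq y ++ map (gam y) w | y <- B, w <- Wb y] <= size B * d)%N.
    rewrite size_allpairs_dep; elim: (B) Wbd => [//|y B' IH] h /=.
    rewrite mulSn leq_add ?h ?mem_head // IH // => z zB; apply: h; by rewrite inE zB orbT.
  rewrite size_allpairs sW !expnS.
  move: sB' szB; set b := size (allpairs_dep _ _ _); move: (size B) (size t) (d.+1 ^ n)%N (d ^ n)%N.
  move=> sb st x y h1 h2.
  apply: (@leq_trans (sb * d * (d.+1 * x))); first by rewrite leq_mul2r h1 orbT.
  have -> : (sb * d * (d.+1 * x) = d * d.+1 * (sb * x))%N by ring.
  have -> : (d * y * (st * d.+1) = d * d.+1 * (y * st))%N by ring.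
  by rewrite leq_mul2l h2 orbT.
move=> eps e0.
(* For n > d / eps the bound d / (d+n) is below eps. *)
pose n := (Num.bound (d%:R / eps)).+1.
have [Y [t [B [_ orbt [t0 Bt] _ [TB szB]]]]] := levels n.
have [l [cl tl]] := cylinder_cover orbt Bt t0 TB.
exists l; split=> //; apply: le_lt_trans tl _.
have key : (size B * n <= d * size t)%N.
  have x0 : (0 < d.+1 ^ n)%N by rewrite expn_gt0.
  have := pow_ratio_bound d n.
  move: (size B) (size t) (d.+1 ^ n)%N (d ^ n)%N szB x0 => b st x y h1 x0 h2.
  have h3 : (b * x * (d + n) <= x * d * st)%N.
    apply: (@leq_trans (y * st * (d + n))); first by rewrite leq_mul2r h1 orbT.
    by have -> : (y * st * (d + n) = y * (d + n) * st)%N; [ring|rewrite leq_mul2r h2 orbT].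
  have h4 : (b * (d + n) <= d * st)%N.
    rewrite -(leq_pmul2r x0); apply: leq_trans (leq_trans _ h3) _; apply: eq_leq; ring.
  by apply: leq_trans h4; rewrite leq_mul2l leq_addl orbT.
have n0 : 0 < n%:R :> rat by rewrite ltr0n.
have t0' : 0 < (size t)%:R :> rat by rewrite ltr0n.
rewrite ltr_pdivrMr //.
have hb : d%:R / eps < n%:R.
  have h0 : 0 <= d%:R / eps by rewrite divr_ge0 ?ler0n // ltW.
  apply: lt_trans (archi_boundP h0) _; by rewrite ltr_nat.
rewrite -(ltr_pM2r n0) -natrM.
apply: (@le_lt_trans _ _ (d * size t)%:R); first by rewrite ler_nat.
rewrite natrM mulrAC ltr_pM2r //.
by move: hb; rewrite ltr_pdivrMr // mulrC.
Qed.

End Measure.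

(** * Large orbits and conclusion *)

Section LargeOrbits.

Variables (E : fieldType) (K : E -> Prop).
Hypothesis baseK : galois_base K.
Hypothesis hilbK : hilbertian K.

(* Separable in every characteristic, including 2. *)
Definition quadratic : {poly {poly E}} := 'X^2 - 'X - ('X)%:P.

Lemma size_quadratic : size quadratic = 3 /\ quadratic \is monic.
Proof.
have -> : quadratic = 'X^2 - ('X + ('X)%:P) by rewrite /quadratic -addrA -opprD.
have s2 : size ('X + ('X)%:P : {poly {poly E}}) = 2 by rewrite size_XaddC.
have lt : (size (- ('X + ('X)%:P) : {poly {poly E}}) < size ('X^2 : {poly {poly E}}))%N.
  by rewrite size_polyN s2 size_polyXn.
split; first by rewrite size_polyDl // size_polyXn.
by rewrite monicE lead_coefDl // lead_coefXn.
Qed.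

(** A proper factorization would give p in E[X] with p^2 - p = X, but the left side is constant or
    of even degree. *)
Lemma quadratic_irreducible : absolutely_irreducible quadratic.
Proof.
have [s3 m3] := size_quadratic; split=> //; first by rewrite s3.
  apply: (separable_specialize m3 (a := 0)).
  have -> : specialize quadratic 0 = \prod_(z <- [:: 0; 1]) ('X - z%:P).
    rewrite specializeE !rmorphB /= map_polyXn map_polyX map_polyC /= /horner_eval hornerX.
    by rewrite big_cons big_seq1 subr0 subr0 mulrBr mulr1 expr2.
  by rewrite separable_prod_XsubC /= inE eq_sym oner_eq0.
have noroot (p : {poly E}) : quadratic.[p] <> 0.
  rewrite !hornerE => /eqP; rewrite subr_eq0 => /eqP e.
  have [sp|sp] := leqP (size p) 1.
    move: e; rewrite (size1_polyC sp) expr2 -polyCM -polyCB => /(congr1 (size \o polyseq)) /=.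
    by rewrite size_polyX size_polyC; case: (_ != 0).
  have p0 : p != 0 by rewrite -size_poly_gt0 ltnW.
  have sp2 : size (p ^+ 2) = (size p + size p).-1 by rewrite expr2 size_mul.
  move/(congr1 (size \o polyseq)): e; rewrite /= size_polyX size_polyDl ?sp2.
    by move: (size p) sp; clear => n; lia.
  by rewrite size_polyN; move: (size p) sp; clear => n; lia.
move=> A B mA mB e; apply: contrapT => /not_orP [sA sB].
have := congr1 (size \o polyseq) e; rewrite /= s3 size_Mmonic ?monic_neq0 // => eAB.
have sA2 : size A = 2.
  move: (monic_neq0 mA) (monic_neq0 mB) eAB sA sB; rewrite -!size_poly_gt0.
  by move: (size A) (size B); clear => a b; lia.
have := noroot (- A`_0); apply; rewrite e hornerM.
have -> : A.[- A`_0] = 0; last by rewrite mul0r.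
have A1 : A`_1 = 1 by move/monicP: mA; rewrite /lead_coef sA2.
by rewrite horner_coef sA2 big_ord_recl big_ord1 /= expr0 expr1 A1 mulr1 mul1r subrr.
Qed.

Lemma orbit_list_exists (Y : seq E) : exists t, is_orbit K Y t.
Proof.
have [th hth] := primitive_list baseK Y.
have [o [uo ho]] := orbit_exists baseK th (fun (s : {rmorphism E -> E}) (h : Kaut K s) => h).
have ht y : exists s : {rmorphism E -> E}, Kaut K s /\ (y \in o -> s th = y).
  have [/ho [s sK es]|ny] := boolP (y \in o); first by exists s.
  by exists idfun; split=> //; apply: Kaut_id.
have {ht} /choice [tau tauP] := ht.
have same (s t : {rmorphism E -> E}) : Kaut K s -> Kaut K t ->
    s th = t th <-> map s Y = map t Y.
  move=> sK tK; have [t' [t'K tt' t't]] := gal_inv tK.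
  have [u [uK eu]] := gal_comp t'K sK; split=> h.
    apply/eq_in_map => x xY; apply: (can_inj t't); rewrite tt' -eu.
    by apply: (hth u uK).1 => //; rewrite eu h tt'.
  apply: (can_inj t't); rewrite tt' -eu; apply/(hth u uK) => x xY.
  have := congr1 (fun l => nth 0 l (index x Y)) h.
  by rewrite !(nth_map 0) ?index_mem // nth_index // eu => ->; rewrite tt'.
exists [seq map (tau y) Y | y <- o]; split.
  rewrite map_inj_in_uniq // => y y' yo y'o.
  have [tK ty] := tauP y; have [tK' ty'] := tauP y'.
  by move/(same _ _ tK tK'); rewrite ty // ty'.
move=> z; split=> [/mapP [y yo ->]|[s sK ->]].
  by have [tK _] := tauP y; exists (tau y).
have [s' es] := Kaut_rmorphism sK.
have s'K : Kaut K s' by rewrite -es.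
have yo : s' th \in o by apply/ho; exists s'.
apply/mapP; exists (s' th) => //; have [tK ty] := tauP (s' th).
by rewrite es; apply/(same _ _ s'K tK); rewrite ty.
Qed.

(** Adjoining a root of a specialization of [quadratic] irreducible over K(th) at least doubles the
    orbit. Large orbits give the cosets of small weight. *)
Lemma large_orbit n : exists Y t, is_orbit K Y t /\ (n < size t)%N.
Proof.
elim: n => [|n [Y [t [[ut ht] lt]]]].
  have [t [ut ht]] := orbit_list_exists [::]; exists [::], t; split=> //.
  have : [::] \in t by apply/ht; exists id => //; apply: Kaut_id.
  by case: (t).
have [th hth] := primitive_list baseK Y.
have irrq := quadratic_irreducible; have [mq sq sepq _] := irrq.
have fq : stable K th quadratic.
  move=> s sK _; rewrite /act /quadratic !rmorphB /= map_polyXn map_polyX map_polyC /=.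
  by rewrite map_polyX.
have [u [Ku _ sepu tru]] := hilbert_theta baseK hilbK [::] (absolutely_irreducible_stable irrq fq) sepq.
have [rs urs ers] := base_split baseK (specialize_monic u mq) sepu.
have srs : size rs = 2.
  have := size_specialize u mq; rewrite ers size_prod_XsubC size_quadratic.1.
  by case.
case: rs urs ers srs => [|v [|w []]] //= /andP [nvw _] ers _.
have [t' [ut' ht']] := orbit_list_exists (v :: Y).
exists (v :: Y), t'; split=> //.
have hg y : exists s : E -> E, Kaut K s /\ (y \in t -> y = map s Y).
  have [/ht [s sK ->]|ny] := boolP (y \in t); first by exists s.
  by exists id; split=> //; apply: Kaut_id.
have {hg} /choice [gam gamP] := hg.
have sub : {subset [seq gam y z :: y | y <- t, z <- [:: v; w]] <= t'}.
  move=> _ /allpairsP [[y z] /= [yt zvw ->]]; apply/ht'.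
  have [gK gy] := gamP y.
  have [||s [sK sth sv]] := tru v z.
  - by rewrite ers root_prod_XsubC mem_head.
  - by rewrite ers root_prod_XsubC.
  exists (gam y \o s); first exact: Kaut_comp.
  rewrite /= sv; congr cons; rewrite [LHS](gy yt); apply/eq_in_map => x xY /=.
  by rewrite (hth s sK).1.
have uniq2 : uniq [seq gam y z :: y | y <- t, z <- [:: v; w]].
  apply: allpairs_uniq => //; first by rewrite /= andbT.
  move=> [y z] [y' z'] _ _ /= [+ ey]; rewrite ey.
  by have [[_ _ _ [g' gg' _] _] _] := gamP y' => /(can_inj gg') ->.
apply: leq_trans (uniq_leq_size uniq2 sub); rewrite size_allpairs /= muln2 -addnn.
by rewrite -addn1 leq_add // (leq_ltn_trans _ lt).
Qed.

Lemma small_coset e (eps : rat) : (0 < e)%N -> 0 < eps -> exists c : coset K e, weight c < eps.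
Proof.
move=> e0 eps0; have [Y [t [orbt lt]]] := large_orbit (Num.bound eps^-1).
have orb : orbit_size K Y (size t) by exists t; case: orbt.
exists (@Coset _ _ _ Y (fun=> id) (size t) (fun=> Kaut_id K) orb).
have h0 : 0 <= eps^-1 by rewrite invr_ge0 ltW.
rewrite /weight /= -[eps]invrK ltf_pV2 ?posrE ?invr_gt0 ?ltr0n ?expn_gt0 ?(leq_ltn_trans _ lt) //.
apply: lt_le_trans (archi_boundP h0) _; rewrite ler_nat.
by apply: leq_trans (ltnW lt) _; rewrite -{1}[size t]expn1 leq_pexp2l ?(leq_ltn_trans _ lt).
Qed.

End LargeOrbits.

Section LocalNull.

Variables (E : fieldType) (K L : E -> Prop) (e : nat).
Hypothesis baseK : galois_base K.
Hypothesis hilbK : hilbertian K.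
Hypothesis galL : galois_ext K L.

(** The restriction of sg to K(th1) is recorded by a list of elements, so that the parameters range
    over a countable set. *)
Definition bad_near f bl th1 (im : seq E) (sg : 'I_e -> E -> E) :=
  bad_for K L f bl sg /\ forall nu, sg nu th1 = nth 0 im nu.

Lemma bad_locally_null f bl (sg0 : 'I_e -> E -> E) (i0 : 'I_e) :
  (forall nu, Kaut K (sg0 nu)) -> bad_for K L f bl sg0 ->
  exists th1 im, (forall nu : 'I_e, sg0 nu th1 = nth 0 im nu) /\
    null_set K (bad_near f bl th1 im).
Proof.
move=> sg0K bad0; have [irrf mf sepf _] := bad0.
have sf : (1 < size f)%N.
  rewrite ltn_neqAle eq_sym size_poly_gt0 monic_neq0 // andbT.
  apply/eqP => s1; have [_ _ nu _] := irrf; apply: nu.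
  by rewrite (monic_size1 mf s1); split; rewrite ?size_poly1 // coef1 size_poly1.
have [f1 irr1 f1f] := absolutely_irreducible_factor mf sf sepf.
have [th0 [nth0 st0]] := normal_stable baseK f1.
have [z0 Mz0 [zs0 [uzs0 szs0 hzs0]]] := bad_many_conjugates baseK hilbK galL sg0K bad0 irr1 f1f st0.
(* Exactly as many conjugates as f1(a,Y) has roots are kept, so that they can be paired. *)
pose zs := take (size f1).-1 zs0.
have uzs : uniq zs by apply: take_uniq.
have szs : size zs = (size f1).-1 by rewrite size_takel.
have ht z : exists s : {rmorphism E -> E}, [/\ Kaut K s, s th0 = th0 & z \in zs -> s z0 = z].
  have [/mem_take /hzs0 [s [sK sth sz]]|nz] := boolP (z \in zs); first by exists s.
  by exists idfun; split=> //; apply: Kaut_id.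
have {ht} /choice [tau tauP] := ht.
have [th1 nth1 fth1] := normal_primitive baseK [:: th0; z0].
have fix1 x : x \in [:: th0; z0] -> fixed_by K th1 x.
  move=> xin s sK sth1; have [s' es] := Kaut_rmorphism sK.
  by rewrite es; apply: fth1; rewrite -?es.
have fth0 := fix1 th0 (mem_head _ _).
have fz0 : fixed_by K th1 z0 by apply: fix1; rewrite !inE eqxx orbT.
exists th1, [seq sg0 nu th1 | nu <- enum 'I_e].
have im_nth (nu : 'I_e) : nth 0 [seq sg0 nu th1 | nu <- enum 'I_e] nu = sg0 nu th1.
  by rewrite (nth_map nu) ?size_enum_ord // nth_ord_enum.
split=> //.
have D0 : (0 < size zs ^ size zs)%N.
  rewrite expn_gt0 szs; have [_ s1 _ _] := irr1.
  by case: (size f1) s1 => [|[|]].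
apply: (@independent_stages _ _ _ baseK i0 _ th1 (sg0 i0 th1) (size zs ^ size zs).-1).
- by exists (sg0 i0).
- by move=> sg _ [_ ->].
rewrite prednK // => Y th1Y.
have [ys [ws [W [uW sW hW exW TW]]]] := stage baseK hilbK galL bl sg0K
  irrf mf sepf irr1 f1f nth0 st0 nth1 fth0 Mz0 fz0 i0 uzs szs tauP th1Y.
exists ys, ws, W; split=> // sg sgK [badsg agr]; apply: TW => // nu.
by rewrite agr im_nth.
Qed.

Lemma not_hilbertian_bad (sg : 'I_e -> E -> E) : ~ hilbertian (fixed_part K L sg) ->
  exists f bl, bad_for K L f bl sg.
Proof.
move=> nh; apply: contrapT => h; apply: nh => f irr mf /separable_in_YP sf [bl hbl].
by apply: h; exists f, bl.
Qed.

End LocalNull.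

Lemma enumerate_bad_data (E : fieldType) (en : nat -> E) :
  (forall x, exists n, en n = x) ->
  exists dec : nat -> {poly {poly E}} * seq E * E * seq E, forall d, exists n, dec n = d.
Proof.
move=> en_surj; have /choice [ix ixP] := en_surj.
exists (fun n => if unpickle n is Some (a, b, c, d) then
   (Poly [seq Poly (map en s) | s <- a], map en b, en c, map en d) else (0, [::], 0, [::])).
move=> [[[f bl] th] im].
have mapK s : map en (map ix s) = s by rewrite -map_comp map_id_in // => x _ /=.
exists (pickle ([seq map ix (p : {poly E}) | p <- f : {poly {poly E}}], map ix bl, ix th, map ix im)).
rewrite pickleK !mapK ixP; congr (_, _, _, _).
rewrite -map_comp map_id_in ?polyseqK // => p _ /=.
by rewrite mapK polyseqK.
Qed.

Theorem theorem1p1 (E : fieldType) (K L : E -> Prop) (e : nat) :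
  is_subfield K -> countable_pred K -> sep_closure K -> hilbertian K ->
  (1 <= e)%N -> galois_ext K L ->
  @haar_null E K e (fun sg : 'I_e -> E -> E => ~ hilbertian (fixed_part K L sg)).
Proof.
move=> subK cK sepK hilbK e0 galL.
have enumE := countable_closure cK sepK.
have baseK : galois_base K by split=> //; apply: hilbertian_infinite.
have [en en_surj] := enumE; have [dec dec_surj] := enumerate_bad_data en_surj.
pose near d : ('I_e -> E -> E) -> Prop := let: (f, bl, th1, im) := d in bad_near K L f bl th1 im.
(* Parameters whose set is not known to be null contribute the empty set; [bad_locally_null] puts
   every bad family into one of the others. *)
pose T n sg := null_set K (near (dec n)) /\ near (dec n) sg.
apply: (null_countable_union (fun eps => small_coset baseK hilbK e0) (T := T)).
  move=> n; have [nn|nn] := EM (null_set K (near (dec n))).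
    by apply: null_set_sub nn => sg [].
  move=> eps eps0; exists [::]; split; first by move=> sg _ [].
  by rewrite /total big_nil.
move=> sg sgK /not_hilbertian_bad [f [bl badsg]].
have [th1 [im [agr nn]]] := bad_locally_null baseK hilbK galL (Ordinal e0) sgK badsg.
have [n en_d] := dec_surj (f, bl, th1, im).
by exists n; rewrite /T en_d.
Qed.
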